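(* Let $[\mathfrak A,n,0,\beta]$ be a maximal simple stratum in $A=\mathrm{End}_F(V)$ with $F[\beta]/F$ tamely ramified, and let $[\mathfrak A,n,r_i,\beta_i]$, $0\le i\le s$, be a defining sequence of it with $\beta_0=\beta$ such that, for $0\le i\le s-1$, $F[\beta_{i+1}]\subsetneq F[\beta_i]$ and $[\mathfrak B_{\beta_{i+1}},r_{i+1},r_{i+1}-1,\beta_i-\beta_{i+1}]$ is a simple stratum in $\mathrm{End}_{F[\beta_{i+1}]}(V)$. Assume $\beta_s\notin F$. Put $E_i=F[\beta_i]$, $B_i=\mathrm{End}_{E_i}(V)$ for $0\le i\le s$, $c_i=\beta_i-\beta_{i+1}$ for $0\le i\le s-1$ and $c_s=\beta_s$. Let $\theta\in\mathcal C(\mathfrak A,0,\beta)$ be a simple character. Then there exist smooth characters $\phi_0,\dots,\phi_s$ of $E_0^\times,\dots,E_s^\times$ such that $$\theta=\prod_{i=0}^s\theta^i,$$ where $\theta^i$ is the character of $H^1(\beta,\mathfrak A)$ determined by $$\theta^i|_{H^1(\beta,\mathfrak A)\cap B_i}=\phi_i\circ{\det}_{B_i},\qquad \theta^i|_{H^1(\beta,\mathfrak A)\cap U^{[-\nu_{\mathfrak A}(c_i)/2]+1}(\mathfrak A)}=\psi_{c_i}.$$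
   Context: $F$ is a non-Archimedean local field with ring of integers $\mathfrak o_F$ and maximal ideal $\mathfrak p_F$; $\psi:F\to\mathbb C^\times$ is a fixed additive character of conductor $\mathfrak p_F$ (trivial on $\mathfrak p_F$, not on $\mathfrak o_F$). $V$ is a finite-dimensional $F$-vector space, $A=\mathrm{End}_F(V)$; $[x]$ is the integer part. For $b\in A$, $\psi_b(x)=\psi(\mathrm{Tr}_{A/F}(b(x-1)))$. $\det_{B_i}:B_i^\times\to E_i^\times$ is the determinant. A hereditary $\mathfrak o_F$-order in $A$ is $\mathfrak A=\{x\in A: xL_i\subset L_i\ \forall i\}$ for an $\mathfrak o_F$-lattice chain $\{L_i\}_{i\in\mathbb Z}$ in $V$; $\mathfrak P$ is its Jacobson radical, $\nu_{\mathfrak A}(x)=\max\{k\in\mathbb Z: x\in\mathfrak P^k\}$, $\mathfrak K(\mathfrak A)$ its normaliser in $A^\times$, $U^0(\mathfrak A)=\mathfrak A^\times$, $U^k(\mathfrak A)=1+\mathfrak P^k$ for $k\ge1$ (same notation for hereditary orders in $\mathrm{End}_K(V)$). A stratum in $A$ is $[\mathfrak A,n,r,\beta]$ with $\mathfrak A$ a hereditary $\mathfrak o_F$-order, $n>r$ integers, $\beta\in A$, $\nu_{\mathfrak A}(\beta)\ge -n$. It is pure if $E=F[\beta]$ is a field, $E^\times\subset\mathfrak K(\mathfrak A)$ and $\nu_{\mathfrak A}(\beta)=-n$. For a pure stratum put $\mathfrak N_k(\beta,\mathfrak A)=\{x\in\mathfrak A:\beta x-x\beta\in\mathfrak P^k\}$,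 $B_\beta=\mathrm{End}_{F[\beta]}(V)$, $\mathfrak B_\beta=\mathfrak A\cap B_\beta$, and $k_0(\beta,\mathfrak A)=-\infty$ if $E=F$, $k_0(\beta,\mathfrak A)=\max\{k:\mathfrak N_k(\beta,\mathfrak A)\not\subset\mathfrak B_\beta+\mathfrak P\}$ if $E\ne F$. A stratum is simple if it is pure and $r<-k_0(\beta,\mathfrak A)$. A simple stratum is maximal if $\mathfrak B_\beta$ is a maximal $\mathfrak o_E$-order in $\mathrm{End}_E(V)$. Strata $[\mathfrak A,n,r,\beta_1]$, $[\mathfrak A,n,r,\beta_2]$ are equivalent ($\sim$) if $\beta_1-\beta_2\in\mathfrak P^{-r}$. The same notions are used in $\mathrm{End}_K(V)$ with $F$ replaced by $K$. A tame corestriction on $A$ relative to $K/F$ (with $B=\mathrm{End}_K(V)$) is a $(B,B)$-bimodule homomorphism $s:A\to B$ with $s(\mathfrak A)=\mathfrak A\cap B$ for every hereditary $\mathfrak o_F$-order $\mathfrak A$ normalised by $K^\times$. A defining sequence of $[\mathfrak A,n,r,\beta]$ is a family $[\mathfrak A,n,r_i,\beta_i]$, $0\le i\le s$, such that: (i) each is simple; (ii) $[\mathfrak A,n,r_0,\beta_0]\sim[\mathfrak A,n,r,\beta]$; (iii) $r=r_0<\dots<r_s<n$ and $[F[\beta_0]:F]>\dots>[F[\beta_s]:F]$; (iv) for $0\le i\le s-1$, $r_{i+1}=-k_0(\beta_i,\mathfrak A)$ and $[\mathfrak A,n,r_{i+1},\beta_{i+1}]\sim[\mathfrak A,n,r_{i+1},\beta_i]$;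 (v) $k_0(\beta_s,\mathfrak A)\in\{-n,-\infty\}$; (vi) for $0\le i\le s-1$, $[\mathfrak B_{\beta_{i+1}},r_{i+1},r_{i+1}-1,s_{i+1}(\beta_i-\beta_{i+1})]$ is equivalent to a simple stratum, $s_{i+1}$ a tame corestriction relative to $F[\beta_{i+1}]/F$. Groups: $\mathfrak H(\beta_s,\mathfrak A)=\mathfrak B_{\beta_s}+\mathfrak P^{[n/2]+1}$; for $i<s$, $\mathfrak H(\beta_i,\mathfrak A)=\mathfrak B_{\beta_i}+\mathfrak H(\beta_{i+1},\mathfrak A)\cap\mathfrak P^{[r_{i+1}/2]+1}$; $H^m(\beta_i,\mathfrak A)=\mathfrak H(\beta_i,\mathfrak A)\cap U^m(\mathfrak A)$. Simple characters: for $0\le m\le n-1$, $\mathcal C(\mathfrak A,m,\beta_s)$ is the set of characters $\theta$ of $H^{m+1}(\beta_s,\mathfrak A)$ with $\theta=\psi_{\beta_s}$ on $H^{m+1}(\beta_s,\mathfrak A)\cap U^{[n/2]+1}(\mathfrak A)$ and $\theta|_{H^{m+1}(\beta_s,\mathfrak A)\cap B_{\beta_s}^\times}$ factoring through $\det_{B_{\beta_s}}$. For $i<s$ and $0\le m\le r_{i+1}-1$, $\mathcal C(\mathfrak A,m,\beta_i)$ is the set of characters $\theta$ of $H^{m+1}(\beta_i,\mathfrak A)$ such that $\theta|_{H^{m+1}(\beta_i,\mathfrak A)\cap B_{\beta_i}^\times}$ factors through $\det_{B_{\beta_i}}$, $\theta$ is normalised by $\mathfrak K(\mathfrak B_{\beta_i})$,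 and with $m'=\max\{m,[r_{i+1}/2]\}$, $\theta|_{H^{m'+1}(\beta_i,\mathfrak A)}=\theta_0\psi_{\beta_i-\beta_{i+1}}$ for some $\theta_0\in\mathcal C(\mathfrak A,m',\beta_{i+1})$. All these objects are independent of the defining sequence. *)

(* Defs.v *)
From HB Require Import structures.
From mathcomp Require Import all_boot all_order all_algebra.
From mathcomp Require Import boolp classical_sets reals constructive_ereal.
From mathcomp Require Import complex.

Set Implicit Arguments.
Unset Strict Implicit.
Unset Printing Implicit Defensive.
Set Warnings "-redundant-canonical-projection".

Import Order.TTheory GRing.Theory Num.Theory.
Local Open Scope classical_set_scope.
Local Open Scope ring_scope.

(* A non-Archimedean local field: complete with respect to a normalised        *)
(* discrete valuation, with finite residue field.                              *)
Record local_valuation (F : fieldType) := LocalValuation {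
  lval :> F -> \bar int;
  lval_eqy : forall x, lval x = +oo%E <-> x = 0;
  lvalM : forall x y, lval (x * y) = (lval x + lval y)%E;
  lvalD : forall x y, (Order.min (lval x) (lval y) <= lval (x + y))%E;
  lval_uniformizer : exists x, lval x = 1%:E;
  lval_complete : forall u : nat -> F,
    (forall k : int, exists N : nat, forall i j : nat, (N <= i)%N -> (N <= j)%N ->
       (k%:E <= lval (u i - u j))%E) ->
    exists l : F, forall k : int, exists N : nat, forall i : nat, (N <= i)%N ->
       (k%:E <= lval (u i - l))%E;
  lval_residue_finite : exists t : seq F, forall x, (0 <= lval x)%E ->
    exists2 y, y \in t & (0 < lval (x - y))%E
}.

(* The library does not put a canonical ring structure on 'End(V); the product *)
(* chosen here is ordinary composition, (f * g) w = f (g w).                   *)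
Section EndRing.
Variables (F : fieldType) (V : vectType F).

HB.instance Definition _ := GRing.Zmodule_isPzRing.Build 'End(V)
  (@comp_lfunA _ _ _ _ _) (@comp_lfun1l _ _ _) (@comp_lfun1r _ _ _)
  (@comp_lfunDl _ _ _ _) (@comp_lfunDr _ _ _ _).

End EndRing.

Definition is_max (P : set int) (k : int) : Prop :=
  P k /\ forall l, P l -> (l <= k)%R.

(* Everything takes place inside A = End_F(V).  The fields E = F[beta], and    *)
(* likewise F itself (as scalar_field), are subsets of A; for such a field K,  *)
(* End_K(V) is the centraliser of K in A.  The notions for End_K(V) take K as  *)
(* an argument, and K = scalar_field gives those for A.                        *)
Section Strata.
Variables (F : fieldType) (v : local_valuation F) (V : vectType F).
Local Notation A := 'End(V).
Implicit Types (K E S I X Y : set A) (b x : A) (n r k : int).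

Definition scalar_field : set A := range (fun a : F => a *: (1 : A)).

Definition End_over K : set A := [set x | forall a, K a -> x * a = a * x].

Definition units_of S : set A :=
  [set x | S x /\ exists2 y, S y & x * y = 1 /\ y * x = 1].

Definition is_subring S : Prop :=
  S 1 /\ forall x y, S x -> S y -> S (x - y) /\ S (x * y).

Definition is_subfield K : Prop :=
  [/\ (1 : A) <> 0, is_subring K, forall x y, K x -> K y -> x * y = y * x
    & forall x, K x -> x <> 0 -> units_of K x].

Definition adjoin K b : set A :=
  [set x | exists2 t : seq A, (forall a, a \in t -> K a)
         & x = \sum_(i < size t) t`_i * b ^+ i].

Definition degree E : nat :=
  xget 0%N [set d | exists2 U : {vspace A}, [set` U] = E & \dim U = d].

(* o_K is the integral closure of o_F in K. *)
Definition integers K : set A :=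
  [set x | K x /\ exists p : {poly F},
     [/\ p \is monic, forall i, (0 <= v p`_i)%E
       & \sum_(i < size p) p`_i *: x ^+ i = 0]].

Definition max_ideal K : set A := integers K `\` units_of (integers K).

(* In the next three definitions M is V or A, and act is evaluation or         *)
(* multiplication.                                                             *)
Definition sums_of_products (M : zmodType) (act : A -> M -> M)
    (X : set A) (L : set M) : set M :=
  [set w | exists2 t : seq (A * M), (forall p, p \in t -> X p.1 /\ L p.2)
         & w = \sum_(p <- t) act p.1 p.2].

Definition combinations (M : zmodType) (act : A -> M -> M)
    (X : set A) (t : seq M) : set M :=
  [set w | exists2 a : nat -> A, (forall i, X (a i))
         & w = \sum_(i < size t) act (a i) t`_i].

(* L is an o_K-lattice in the K-vector space W: a finitely generated           *)
(* o_K-submodule spanning W over K.                                            *)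
Definition is_lattice (M : zmodType) (act : A -> M -> M) K (W L : set M) : Prop :=
  exists t : seq M,
    combinations act (integers K) t = L /\ combinations act K t = W.

Definition evalV (x : A) (w : V) : V := x w.

Definition mulset X Y : set A := sums_of_products *%R X Y.

Definition lattice_chain K (L : int -> set V) : Prop :=
  [/\ forall i, is_lattice evalV K [set: V] (L i),
      forall i, L (i + 1) `<` L i
    & exists2 e : nat, (0 < e)%N &
        forall i, L (i + e%:Z) = sums_of_products evalV (max_ideal K) (L i)].

Definition hereditary_order K S : Prop :=
  exists2 L, lattice_chain K L
    & S = [set x | End_over K x /\ forall i w, L i w -> L i (x w)].

Definition left_ideal S I : Prop :=
  [/\ I `<=` S, I 0, forall x y, I x -> I y -> I (x + y)
    & forall x y, S x -> I y -> I (x * y)].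

Definition maximal_left_ideal S I : Prop :=
  [/\ left_ideal S I, I <> S
    & forall J, left_ideal S J -> I `<=` J -> J = I \/ J = S].

Definition jacobson_radical S : set A :=
  [set x | S x /\ forall I, maximal_left_ideal S I -> I x].

Definition ideal_pow S I (m : nat) : set A := iter m (mulset I) S.

(* P^k for k in Z, with P the radical of S; negative powers are the inverse    *)
(* fractional ideals in End_K(V).                                              *)
Definition radical_pow K S k : set A :=
  match k with
  | Posz m => ideal_pow S (jacobson_radical S) m
  | Negz m => [set x | End_over K x /\
                forall y, ideal_pow S (jacobson_radical S) m.+1 y -> S (x * y)]
  end.

Definition nu K S x : \bar int :=
  if x == 0 then +oo%E else
  (xget (0 : int) (is_max [set k | radical_pow K S k x]))%:E.

Definition unit_group K S k : set A :=
  if k == 0 then units_of S else [set 1 + x | x in radical_pow K S k].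

Definition order_normaliser K S : set A :=
  [set g | End_over K g /\ exists h,
     [/\ End_over K h, g * h = 1, h * g = 1 & [set g * x * h | x in S] = S]].

Definition stratum K S n r b : Prop :=
  [/\ hereditary_order K S, (r < n)%R, End_over K b
    & ((- n)%:E <= nu K S b)%E].

Definition pure_stratum K S n r b : Prop :=
  [/\ stratum K S n r b, is_subfield (adjoin K b),
      units_of (adjoin K b) `<=` order_normaliser K S
    & nu K S b = (- n)%:E].

(* The order B_beta = S \cap End_{K[beta]}(V). *)
Definition centraliser_order K S b : set A := S `&` End_over (adjoin K b).

Definition frakN K S b k : set A :=
  [set x | S x /\ radical_pow K S k (b * x - x * b)].

Definition k0 K S b : \bar int :=
  if `[< adjoin K b = K >] then -oo%E else
  (xget (0 : int) (is_max [set k | ~ (frakN K S b k `<=`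
     [set x + y | x in centraliser_order K S b & y in jacobson_radical S])]))%:E.

Definition simple_stratum K S n r b : Prop :=
  pure_stratum K S n r b /\ (r%:E < - k0 K S b)%E.

Definition is_order K S : Prop :=
  [/\ S `<=` End_over K, is_subring S & is_lattice *%R K (End_over K) S].

Definition maximal_order K S : Prop :=
  is_order K S /\ forall S', is_order K S' -> S `<=` S' -> S' = S.

Definition maximal_simple_stratum K S n r b : Prop :=
  simple_stratum K S n r b /\ maximal_order (adjoin K b) (centraliser_order K S b).

(* Equivalence of the strata [S, n, r, b1] and [S, n, r, b2]. *)
Definition strata_equiv K S r b1 b2 : Prop := radical_pow K S (- r) (b1 - b2).

Definition tame_corestriction E (s : A -> A) : Prop :=
  [/\ forall x, End_over E (s x),
      forall x y, s (x + y) = s x + s y,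
      forall x b b', End_over E b -> End_over E b' -> s (b * x * b') = b * s x * b'
    & forall S, hereditary_order scalar_field S ->
        units_of E `<=` order_normaliser scalar_field S ->
        s @` S = S `&` End_over E].

(* e is the ramification index of E/F; separability of the residue extension   *)
(* is automatic since the residue field of F is finite.                        *)
Definition tamely_ramified E : Prop :=
  exists2 e : nat,
    mulset (max_ideal scalar_field) (integers E)
      = ideal_pow (integers E) (max_ideal E) e
  & forall p : nat, prime p -> (0 < v p%:R)%E -> ~~ (p %| e)%N.

(* Determinants over K of elements of End_K(V), via the matrix with respect to *)
(* an arbitrary K-basis of V; det_over_spec determines d independently of it.  *)
Definition is_basis_over K (m : nat) (e : 'I_m -> V) : Prop :=
  (forall w : V, exists2 a : 'I_m -> A, (forall i, K (a i)) & w = \sum_i a i (e i)) /\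
  (forall a : 'I_m -> A, (forall i, K (a i)) -> \sum_i a i (e i) = 0 ->
     forall i, a i = 0).

Definition det_over_spec K x (d : A) : Prop :=
  exists m (e : 'I_m -> V) (M : 'M[A]_m),
    [/\ is_basis_over K e, forall i j, K (M i j),
        forall j, x (e j) = \sum_i M i j (e i) & d = \det M].

Definition det_over K x : A := xget 0 (det_over_spec K x).

Definition trace x : F := \tr (passmx.mxof (vbasis {:V}) (vbasis {:V}) x).

Local Notation "'F[' b ]" := (adjoin scalar_field b).

(* The stratum [S, n, rr i, bb i] is the i-th term, 0 <= i <= s. *)
Record defining_sequence S n r b (s : nat) (rr : nat -> int) (bb : nat -> A) : Prop := {
  ds_simple : forall i, (i <= s)%N -> simple_stratum scalar_field S n (rr i) (bb i);
  ds_start : rr 0%N = r /\ strata_equiv scalar_field S r (bb 0%N) b;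
  ds_incr : (forall i, (i < s)%N -> (rr i < rr i.+1)%R) /\ (rr s < n)%R;
  ds_degree : forall i, (i < s)%N -> (degree F[bb i.+1] < degree F[bb i])%N;
  ds_jump : forall i, (i < s)%N ->
    (rr i.+1)%:E = (- k0 scalar_field S (bb i))%E /\
    strata_equiv scalar_field S (rr i.+1) (bb i.+1) (bb i);
  ds_end : k0 scalar_field S (bb s) = (- n)%:E \/ k0 scalar_field S (bb s) = -oo%E;
  ds_derived : forall i, (i < s)%N ->
    let E := F[bb i.+1] in
    let BB := centraliser_order scalar_field S (bb i.+1) in
    exists2 cores, tame_corestriction E cores &
      let c := cores (bb i - bb i.+1) in
      stratum E BB (rr i.+1) (rr i.+1 - 1) c /\
      exists2 g, simple_stratum E BB (rr i.+1) (rr i.+1 - 1) g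
               & strata_equiv E BB (rr i.+1 - 1) c g
}.

(* frakH_rec (s - i) i is the ring H(beta_i, A); the first argument counts the *)
(* terms of the defining sequence that follow the i-th.                        *)
Fixpoint frakH_rec S n (rr : nat -> int) (bb : nat -> A) (j i : nat) : set A :=
  match j with
  | 0 => [set x + y | x in centraliser_order scalar_field S (bb i)
                    & y in radical_pow scalar_field S ((n %/ 2)%Z + 1)]
  | j'.+1 => [set x + y | x in centraliser_order scalar_field S (bb i)
                        & y in frakH_rec S n rr bb j' i.+1 `&`
                               radical_pow scalar_field S ((rr i.+1 %/ 2)%Z + 1)]
  end.

Definition Hgroup_rec S n rr bb j i (m : int) : set A :=
  frakH_rec S n rr bb j i `&` unit_group scalar_field S m.

Definition Hgroup S n (s : nat) rr bb i m : set A :=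
  Hgroup_rec S n rr bb (s - i) i m.

Section Characters.
Variable (R : realType).
Local Notation C := R[i].
Implicit Types (psi : F -> C) (chi theta : A -> C) (G : set A).

Definition additive_char_conductor_p psi : Prop :=
  [/\ forall y z : F, psi (y + z) = psi y * psi z, forall y : F, psi y <> 0,
      forall y : F, (0 < v y)%E -> psi y = 1
    & exists2 y : F, (0 <= v y)%E & psi y <> 1].

(* chi restricts to a smooth character of the subgroup G of A^*; the values of *)
(* chi outside G are irrelevant.  The o_F-lattices in A form a basis of        *)
(* neighbourhoods of 0.                                                        *)
Definition smooth_char G chi : Prop :=
  [/\ forall x y, G x -> G y -> chi (x * y) = chi x * chi y,
      forall x, G x -> chi x <> 0
    & exists2 L, is_lattice *%R scalar_field [set: A] L
        & forall x, G x -> L (x - 1) -> chi x = 1].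

Definition psi_at psi b x : C := psi (trace (b * (x - 1))).

Definition factors_through_det E G theta : Prop :=
  exists chi, forall x, G x -> units_of (End_over E) x -> theta x = chi (det_over E x).

Definition normalised_by (N G : set A) theta : Prop :=
  forall g h x, N g -> g * h = 1 -> h * g = 1 -> G x ->
    G (g * x * h) /\ theta (g * x * h) = theta x.

Fixpoint simple_char_rec psi S n (rr : nat -> int) (bb : nat -> A)
    (j i : nat) (m : int) theta : Prop :=
  let H := Hgroup_rec S n rr bb j i in
  match j with
  | 0 =>
    [/\ smooth_char (H (m + 1)) theta,
        forall x, H (m + 1) x -> unit_group scalar_field S ((n %/ 2)%Z + 1) x ->
          theta x = psi_at psi (bb i) x
      & factors_through_det F[bb i] (H (m + 1)) theta]
  | j'.+1 =>
    let m' := Order.max m (rr i.+1 %/ 2)%Z in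
    [/\ smooth_char (H (m + 1)) theta,
        factors_through_det F[bb i] (H (m + 1)) theta,
        normalised_by (order_normaliser F[bb i] (centraliser_order scalar_field S (bb i)))
          (H (m + 1)) theta
      & exists2 theta0, simple_char_rec psi S n rr bb j' i.+1 m' theta0
          & forall x, H (m' + 1) x ->
              theta x = theta0 x * psi_at psi (bb i - bb i.+1) x]
  end.

(* The set C(A, m, beta_i), meant for 0 <= m <= n - 1 if i = s and             *)
(* 0 <= m <= r_{i+1} - 1 if i < s.                                             *)
Definition simple_char psi S n (s : nat) rr bb i m theta : Prop :=
  simple_char_rec psi S n rr bb (s - i) i m theta.

End Characters.

End Strata.

Arguments scalar_field {F} V.
Notation "'F[' b ]" := (adjoin (scalar_field _) b) (format "'F[' b ]").

(* Main.v *)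
Require Import Defs.
From HB Require Import structures.
From mathcomp Require Import all_boot all_order all_algebra.
From mathcomp Require Import boolp classical_sets reals constructive_ereal.
From mathcomp Require Import complex.
From mathcomp Require Import zify.

(**
The proof turns the defining sequence into a filtration by groups.  Let
k_i = [r_i/2] + 1 for i <= s, with r_0 = 0, and k_(s+1) = [n/2] + 1; let G_i be
the group of the x in H(beta_i) with x - 1 in P^(k_i), and G_(s+1) = 1 +
P^(k_(s+1)).  Then G_0 = H^1(beta, S), and because the centralisers B_i grow
with i, each G_(i+1) is the normal subgroup of G_0 cut out by the congruence
x = 1 mod P^(k_(i+1)), and G_i = (G_i \cap B_i) G_(i+1).  Iterating,
G_0 = (G_0 \cap B_i) G_(i+1) for every i, so that theta^i is determined by its
two prescriptions, and it exists as soon as they agree on G_(i+1) \cap B_i: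
the character psi_(c_i) is invariant under conjugation by B_i, as c_i lies
in E_i.

Unfolding the definition of a simple character gives characters theta_i of G_i
with theta_0 = theta, theta_i = theta_(i+1) psi_(c_i) on G_(i+1) and theta_s =
psi_(c_s) on G_(s+1), each factoring through det_(B_i) on G_i \cap B_i.  In
particular psi_(c_i) is a smooth character of G_(i+1), being a quotient of two
such.  The phi_i are chosen by descending induction on i so that

  theta_i = \prod_(l >= i) phi_l o det_(B_l)   on G_i \cap B_i.

Given the phi_l with l > i, the quotient of theta_i by their product is a
character of G_i \cap B_i depending on det_(B_i) alone: any character of
GL_m(K), for K with more than two elements, kills the matrices of determinant 1,
so phi_l o det_(B_l) restricted to
B_i^* factors through det_(B_i) ([char_factors_det]).  It thus defines a
character of a subgroup of E_i^*, which extends to E_i^* because C^* is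
divisible ([extend_character]); it is smooth because the determinant has a
section d |-> 1 + (d - 1) p near 1 ([smooth_char_through_det]).  Comparing the
displayed formulas for i and i + 1 on G_(i+1) \cap B_i shows that
phi_i o det_(B_i) = psi_(c_i) there, which is the compatibility wanted, and the
decompositions G_i = (G_i \cap B_i) G_(i+1) then give theta = \prod theta^i
([factorisation]).

It remains to see that the congruence subgroup in the statement is G_(i+1).  For
i < s this means that c_i has valuation - r_(i+1) with respect to S, while the
hypothesis gives its valuation with respect to the order S \cap B_(i+1).  The point is
that the radical of S \cap B_(i+1) is contained in that of S
([nu_centraliser]).  If S is the stabilizer of the lattice chain L, its radical
consists of the x with x L_j contained in L_(j+1) for all j; an element of
E_(i+1)^*, normalising S, shifts the chain ([normaliser_shifts]), and then the
order S \cap B_(i+1) acts transitively enough on L_j / L_(j+1), by rank one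
operators over E_(i+1) ([chain_rank_one]), for its radical to act by zero.
*)

Set Implicit Arguments.
Unset Strict Implicit.
Unset Printing Implicit Defensive.

Import Order.TTheory GRing.Theory Num.Theory.
Local Open Scope classical_set_scope.
Local Open Scope ring_scope.

(** * Characters of general linear groups *)

Section CharactersOfGL.
Variables (k C : fieldType) (t : k).
Hypotheses (t_neq0 : t != 0) (t_neq1 : t != 1).

Let multiplicative_on_units m (chi : 'M[k]_m -> C) :=
  (forall M N, M \in unitmx -> N \in unitmx -> chi (M *m N) = chi M * chi N) /\
  (forall M, M \in unitmx -> chi M != 0).

Let lower_unipotent m (w : 'cV[k]_m) : 'M[k]_(1 + m) := block_mx 1%:M 0 w 1%:M.
Let upper_unipotent m (w : 'rV[k]_m) : 'M[k]_(1 + m) := block_mx 1%:M w 0 1%:M.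

Lemma unit_det1 m (M : 'M[k]_m) : \det M = 1 -> M \in unitmx.
Proof. by rewrite unitmxE => ->; rewrite unitr1. Qed.

Lemma det_lower_unipotent m (w : 'cV[k]_m) : \det (lower_unipotent w) = 1.
Proof. by rewrite det_lblock !det1 mulr1. Qed.

Lemma det_upper_unipotent m (w : 'rV[k]_m) : \det (upper_unipotent w) = 1.
Proof. by rewrite det_ublock !det1 mulr1. Qed.

(** Conjugation by diag(t, 1, ..., 1) multiplies w by t or its inverse, so the
    unipotent block matrix of w is a commutator. *)
Lemma char_unipotent m (chi : 'M[k]_(1 + m) -> C) : multiplicative_on_units chi ->
  (forall w, chi (lower_unipotent w) = 1) /\ (forall w, chi (upper_unipotent w) = 1).
Proof.
move=> [chiM chi0].
pose D : 'M[k]_(1 + m) := block_mx t%:M 0 0 1%:M.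
have uD : D \in unitmx.
  by rewrite unitmxE det_ublock det1 mulr1 det_scalar1 unitfE.
have ul w : lower_unipotent w \in unitmx by apply: unit_det1; apply: det_lower_unipotent.
have uu w : upper_unipotent w \in unitmx by apply: unit_det1; apply: det_upper_unipotent.
have t1 : t - 1 != 0 by rewrite subr_eq0.
split=> w; set w' := (t - 1)^-1 *: w.
- have tw : t *: w' = w + w'.
    by rewrite -[t](subrK 1) scalerDl scale1r scalerA divff // scale1r.
  have : chi (D *m (lower_unipotent w *m lower_unipotent w')) = chi (lower_unipotent w' *m D).
    congr chi; rewrite /lower_unipotent /D !mulmx_block !(mul0mx, mulmx0, mul1mx, mulmx1, addr0, add0r).
    by rewrite mul_mx_scalar -tw.
  rewrite !chiM ?unitmx_mul ?uD ?ul //.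
  by rewrite mulrCA [RHS]mulrC -[RHS]mul1r; apply/mulIf; rewrite mulf_neq0 ?chi0.
- have tw : t *: w' = w + w'.
    by rewrite -[t](subrK 1) scalerDl scale1r scalerA divff // scale1r.
  have : chi (D *m upper_unipotent w') = chi ((upper_unipotent w *m upper_unipotent w') *m D).
    congr chi; rewrite /upper_unipotent /D !mulmx_block !(mul0mx, mulmx0, mul1mx, mulmx1, addr0, add0r).
    by rewrite mul_scalar_mx tw addrC.
  rewrite !chiM ?unitmx_mul ?uD ?uu // [LHS]mulrC -[LHS]mul1r -mulrA => e.
  by apply/esym; move: e; apply/mulIf; rewrite mulf_neq0 ?chi0.
Qed.

(** Row and column operations by unipotent block matrices reduce a matrix of
    determinant 1 to the identity, provided that every pivot is made equal to 1
    on the way; no diagonal matrix is left over. *)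
Theorem char_det1 m (chi : 'M[k]_m -> C) : multiplicative_on_units chi ->
  forall M, \det M = 1 -> chi M = 1.
Proof.
have chi1 p (c : 'M[k]_p -> C) : multiplicative_on_units c -> c 1%:M = 1.
  move=> [cM c0]; apply: (mulfI (c0 _ (unitmx1 _ _))).
  by rewrite -cM ?unitmx1 // mulmx1 mulr1.
elim: m chi => [|m IH] chi hchi M dM.
  have -> : M = 1%:M by apply/matrixP=> -[].
  exact: chi1.
move: chi hchi M dM; rewrite -[m.+1]/(1 + m)%N => chi hchi M dM.
have [chiM chi0] := hchi; have [chiL chiU] := char_unipotent hchi.
have ul w : lower_unipotent w \in unitmx by apply: unit_det1; apply: det_lower_unipotent.
have uu w : upper_unipotent w \in unitmx by apply: unit_det1; apply: det_upper_unipotent.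
(* a pivot equal to 1 clears its row and column and leaves a block of determinant 1 *)
have piv1 N : \det N = 1 -> ulsubmx N = 1%:M -> chi N = 1.
  move=> dN N1; set u := ursubmx N; set w := dlsubmx N.
  pose N' := drsubmx N - w *m u.
  have eN : N = lower_unipotent w *m block_mx 1%:M 0 0 N' *m upper_unipotent u.
    rewrite /lower_unipotent /upper_unipotent !mulmx_block !(mul0mx, mulmx0, mul1mx, mulmx1, addr0, add0r).
    by rewrite /N' addrC subrK -[in LHS](submxK N) N1.
  have dN' : \det N' = 1.
    by move: dN; rewrite eN !det_mulmx det_lower_unipotent det_upper_unipotent det_ublock det1 !mul1r mulr1.
  have hchi' : multiplicative_on_units (fun P : 'M[k]_m => chi (block_mx 1%:M 0 0 P)).
    have ub P : P \in unitmx -> block_mx (1%:M : 'M[k]_1) 0 0 P \in unitmx.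
      by rewrite !unitmxE det_ublock det1 mul1r.
    split=> [P Q uP uQ|P uP]; last by rewrite chi0 ?ub.
    rewrite -chiM ?ub // mulmx_block.
    by rewrite !(mul0mx, mulmx0, mul1mx, mulmx1, addr0, add0r).
  have := IH _ hchi' N' dN' => e.
  have uB : block_mx (1%:M : 'M[k]_1) 0 0 N' \in unitmx.
    by apply: unit_det1; rewrite det_ublock det1 mul1r.
  by rewrite eN !chiM ?unitmx_mul ?ul ?uB ?uu // chiL chiU mulr1 mul1r e.
(* a nonzero entry below the pivot serves to change the pivot to 1 *)
have piv2 N : \det N = 1 -> dlsubmx N != 0 -> chi N = 1.
  move=> dN /cV0Pn [i wi].
  pose u : 'rV[k]_m := ((1 - N (lshift m 0) (lshift m 0)) / dlsubmx N i 0) *: delta_mx 0 i.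
  suff : chi (upper_unipotent u *m N) = 1 by rewrite chiM ?uu ?unit_det1 // chiU mul1r.
  apply: piv1; first by rewrite det_mulmx det_upper_unipotent dN mulr1.
  rewrite -[in LHS](submxK N) mulmx_block block_mxKul mul1mx.
  apply/matrixP=> a b; rewrite !ord1 /u -scalemxAl -rowE !mxE eqxx.
  by rewrite !mxE in wi; rewrite mulfVK // addrC subrK.
(* in size 1 the pivot is the determinant *)
case: (posnP m) => m0.
  have nI (j : 'I_m) : False by case: j => j /=; rewrite m0.
  apply: piv1 => //; apply/matrixP=> a b; rewrite !ord1.
  have : \det M = M (lshift m 0) (lshift m 0).
    rewrite -[in LHS](submxK M).
    have -> : ursubmx M = 0 by apply/matrixP=> ? j; case: (nI j).
    rewrite det_lblock [drsubmx M](_ : _ = 1%:M) ?det1 ?mulr1 ?det_mx11 ?mxE //.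
    by apply/matrixP=> j; case: (nI j).
  by rewrite dM !mxE eqxx => <-.
have [w0|] := eqVneq (dlsubmx M) 0; last exact: piv2.
have a0 : M (lshift m 0) (lshift m 0) != 0.
  apply/eqP=> a0; have := dM; rewrite -(submxK M) w0 det_ublock det_mx11 !mxE a0 mul0r.
  by move/esym/eqP; rewrite oner_eq0.
(* the column below the pivot is zero: add the first row to all the others *)
pose w : 'cV[k]_m := const_mx 1.
suff : chi (lower_unipotent w *m M) = 1 by rewrite chiM ?ul ?unit_det1 // chiL mul1r.
apply: piv2; first by rewrite det_mulmx det_lower_unipotent dM mulr1.
rewrite -[X in _ *m X](submxK M) mulmx_block block_mxKdl w0 mulmx0 addr0.
apply/cV0Pn; exists (Ordinal m0).
by rewrite !mxE big_ord1 !mxE mul1r.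
Qed.

End CharactersOfGL.

(** * Extension of characters of abelian groups *)

(** Zorn's lemma for the sets satisfying P above a given one, when only nonempty
    chains are known to have a union satisfying P. *)
Lemma Zorn_above T (P : set (set T)) (I0 : set T) : P I0 ->
  (forall F : set (set T), F `<=` P -> F !=set0 -> total_on F subset ->
     P (\bigcup_(X in F) X)) ->
  exists A, [/\ P A, I0 `<=` A & forall B, P B -> A `<=` B -> B `<=` A].
Proof.
move=> PI0 chain.
pose P' X := X = set0 \/ (P X /\ I0 `<=` X).
have [F FP' Ftot|A [P'A maxA]] := @Zorn_bigcup T P'.
  pose F' := [set X | F X /\ X !=set0].
  have eF : \bigcup_(X in F) X = \bigcup_(X in F') X.
    apply/seteqP; split=> x [X FX Xx]; last by exists X => //; case: FX.
    by exists X => //; split=> //; exists x.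
  have F'P X : F' X -> P X /\ I0 `<=` X.
    by move=> [/FP' [->|//]] /set0P; rewrite eqxx.
  case: (pselect (F' !=set0)) => [[X F'X]|nF'].
    right; rewrite eF; split; last first.
      by move=> x Ix; exists X => //; apply: (proj2 (F'P _ F'X)).
    apply: chain; first by move=> Y /F'P [].
      by exists X.
    by move=> Y Z [FY _] [FZ _]; apply: Ftot.
  left; rewrite eF; apply/seteqP; split=> // x [X F'X _].
  by apply: nF'; exists X.
case: P'A => [A0|[PA IA]].
  have I00 : I0 = set0.
    apply/eqP; apply/negPn/negP => /set0P [x Ix].
    apply: (maxA I0); last by right; split.
    by rewrite A0; split=> // /(_ x Ix).
  exists I0; split=> // B PB _ x Bx.
  case: (maxA B); last by right; rewrite I00; split=> // y.
  by rewrite A0; split=> // /(_ x Bx).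
exists A; split=> // B PB AB.
apply/not_notP => nBA; apply: (maxA B) => //.
by right; split=> //; apply: subset_trans AB.
Qed.

Section ExtensionOfCharacters.
Variables (k : fieldType) (C : numClosedFieldType).
Implicit Types (Z : set (k * C)).

(** The graph of a character defined on a subgroup of k^*: the last condition
    makes this subgroup of k^* x C^* a graph. *)
Let is_partial_char Z :=
  [/\ Z (1, 1),
      forall p q, Z p -> Z q -> Z (p.1 * q.1, p.2 * q.2),
      forall p, Z p -> Z (p.1^-1, p.2^-1),
      forall p, Z p -> p.1 != 0 /\ p.2 != 0
    & forall c, Z (1, c) -> c = 1].

Lemma partial_charX Z : is_partial_char Z -> forall (j : int) x c,
  Z (x, c) -> Z (x ^ j, c ^ j).
Proof.
move=> [Z1 ZM ZV Z0 Zf] j x c Zxc.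
have Zn n : Z (x ^+ n, c ^+ n).
  elim: n => [|n IH]; first by rewrite !expr0.
  by rewrite !exprS; apply: (ZM (x, c) (x ^+ n, c ^+ n)).
case: j => n; first exact: Zn.
exact: (ZV (x ^+ n.+1, c ^+ n.+1)).
Qed.

Lemma partial_char_fun Z : is_partial_char Z -> forall x c d,
  Z (x, c) -> Z (x, d) -> c = d.
Proof.
move=> [Z1 ZM ZV Z0 Zf] x c d Zc Zd.
have [/= x0 d0] := Z0 _ Zd.
have := ZM _ _ Zc (ZV _ Zd) => /=; rewrite divff // => /Zf /(canRL (divfK d0)).
by rewrite mul1r.
Qed.

(** The value at g has to be an n-th root of the value at g ^ n, where n is the
    order of g modulo the domain, and is free when g has infinite order. *)
Lemma partial_char_extend Z g : is_partial_char Z -> g != 0 ->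
  exists Z', [/\ is_partial_char Z', Z `<=` Z' & exists c, Z' (g, c)].
Proof.
move=> hZ g0; have [Z1 ZM ZV Z0 Zf] := hZ.
have Zfun := partial_char_fun hZ; have ZX := partial_charX hZ.
(* l is compatible with every power of g already in the domain *)
have [l l0 hl] : exists2 l : C, l != 0 & forall (j : int) c, Z (g ^ j, c) -> c = l ^ j.
  pose D n := `[< (0 < n)%N /\ exists c, Z (g ^+ n, c) >].
  case: (pselect (exists n, D n)) => [exD|nD].
    have [n /asboolP [n0 [c Zc]] minn] := ex_minnP exD.
    have c0 : c != 0 by have [] := Z0 _ Zc.
    have e : (n.-root c) ^+ n = c by rewrite rootCK.
    exists (n.-root c); first by apply: contra_neq c0 => l0; rewrite -e l0 expr0n gtn_eqF.
    move=> j d Zd.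
    have nz : n%:Z != 0 by rewrite eqz_nat -lt0n.
    have ej := divz_eq j n; set q := (j %/ n)%Z in ej; set r := (j %% n)%Z in ej.
    have r0 : 0 <= r by apply: modz_ge0.
    have rn : r < n%:Z by apply: ltz_pmod.
    have Zq : Z (g ^ (n%:Z * q), c ^ q) by rewrite -exprz_exp; apply: ZX.
    case: r r0 rn ej => // r _ rn ej.
    have /= Zr := ZM _ _ Zd (ZV _ Zq).
    have er : g ^ j / g ^ (n%:Z * q) = g ^+ r.
      rewrite ej [q * _]mulrC expfzDr // mulrAC divff ?mul1r //.
      exact: expfz_neq0.
    rewrite er in Zr.
    have rz : r = 0%N.
      apply/eqP; rewrite -leqn0 leqNgt; apply/negP => rp.
      have := minn r; rewrite leqNgt -ltz_nat rn => /(_ _)/negP; apply.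
        by apply/asboolP; split=> //; eexists; exact: Zr.
      by [].
    rewrite ej rz addr0 [q * _]mulrC -exprz_exp -exprnP e.
    apply: (Zfun (g ^ j)) => //.
    by rewrite ej rz addr0 [q * _]mulrC.
  exists 1; first exact: oner_neq0.
  have noD n c : Z (g ^+ n.+1, c) -> False.
    by move=> Zc; apply: nD; exists n.+1; apply/asboolP; split=> //; exists c.
  move=> [[|n]|n] c Zc; rewrite exp1rz.
  - by apply: Zf; rewrite expr0z in Zc.
  - by case: (noD _ _ Zc).
  - by have /= := ZV _ Zc; rewrite invrK => /noD.
(* the subgroup generated by Z and (g, l) *)
exists [set p | exists z (j : int), Z z /\ p = (z.1 * g ^ j, z.2 * l ^ j)].
split; [split| |].
- by exists (1, 1), 0; rewrite !expr0z !mulr1.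
- move=> _ _ [z [j [Zz ->]]] [z' [j' [Zz' ->]]] /=.
  exists (z.1 * z'.1, z.2 * z'.2), (j + j'); split; first exact: ZM.
  by rewrite /= !expfzDr // mulrACA [in X in (_, X)]mulrACA.
- move=> _ [z [j [Zz ->]]] /=.
  exists (z.1^-1, z.2^-1), (- j); split; first exact: ZV.
  by rewrite /= !invfM !invr_expz.
- move=> _ [z [j [Zz ->]]] /=; have [z1 z2] := Z0 _ Zz.
  by rewrite !mulf_neq0 ?expfz_neq0.
- move=> c [[z d] [j [Zz [/= e1 ->]]]].
  have gj0 : g ^ j != 0 by apply: expfz_neq0.
  have lj0 : l ^ j != 0 by apply: expfz_neq0.
  have ez : z = g ^ (- j).
    by rewrite -invr_expz; apply: (mulIf gj0); rewrite -e1 mulVf.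
  by rewrite ez in Zz; rewrite (hl _ _ Zz) -invr_expz mulVf.
- by move=> [x c] Zz; exists (x, c), 0; rewrite !expr0z !mulr1.
- by exists l, (1, 1), 1; rewrite !expr1z !mul1r.
Qed.

(** C^* is divisible, hence an injective abelian group. *)
Theorem extend_character (G : set k) (eta : k -> C) :
  G 1 -> (forall x y, G x -> G y -> G (x * y)) ->
  (forall x, G x -> x != 0 /\ G x^-1) ->
  (forall x y, G x -> G y -> eta (x * y) = eta x * eta y) ->
  (forall x, G x -> eta x != 0) ->
  exists phi : k -> C,
    [/\ forall x y, x != 0 -> y != 0 -> phi (x * y) = phi x * phi y,
        forall x, x != 0 -> phi x != 0
      & forall x, G x -> phi x = eta x].
Proof.
move=> G1 GM GV etaM eta0.
have eta1 : eta 1 = 1.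
  by apply: (mulfI (eta0 _ G1)); rewrite -etaM // !mulr1.
pose Z0 : set (k * C) := [set p | G p.1 /\ p.2 = eta p.1].
have pZ0 : is_partial_char Z0.
  split.
  - by split.
  - by move=> [x c] [y d] [/= Gx ->] [/= Gy ->]; split=> /=; [exact: GM|rewrite etaM].
  - move=> [x c] [/= Gx ->]; have [x0 GVx] := GV _ Gx; split=> //=.
    by apply: (mulfI (eta0 _ Gx)); rewrite -etaM // !divff ?eta0.
  - by move=> [x c] [/= Gx ->]; rewrite eta0 //; have [] := GV _ Gx.
  - by move=> c [/= _ ->].
have [F FP [X0 FX0] Ftot|Z [hZ Z0Z maxZ]] := @Zorn_above _ is_partial_char Z0 pZ0.
  have pair X Y : F X -> F Y -> exists W, [/\ F W, X `<=` W & Y `<=` W].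
    move=> FX FY; have [XY|YX] := Ftot _ _ FX FY; first by exists Y; split=> // y.
    by exists X; split=> // y.
  split.
  - by exists X0 => //; have [] := FP _ FX0.
  - move=> p q [X FX Xp] [Y FY Yq]; have [W [FW XW YW]] := pair _ _ FX FY.
    exists W => //; have [_ WM _ _ _] := FP _ FW.
    by apply: WM; [exact: XW|exact: YW].
  - by move=> p [X FX Xp]; exists X => //; have [_ _ XV _ _] := FP _ FX; apply: XV.
  - by move=> p [X FX Xp]; have [_ _ _ X0' _] := FP _ FX; apply: X0'.
  - by move=> c [X FX Xc]; have [_ _ _ _ Xf] := FP _ FX; apply: Xf.
have total x : exists c, x != 0 -> Z (x, c).
  have [->|x0] := eqVneq x 0; first by exists 0.
  have [Z' [hZ' ZZ' [c Z'c]]] := partial_char_extend hZ x0.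
  by exists c => _; apply: (maxZ _ hZ' ZZ').
have [phi hphi] := choice total.
have [Z1 ZM ZV Zn Zf] := hZ.
have Zfun := partial_char_fun hZ.
exists phi; split.
- move=> x y x0 y0; apply: (Zfun (x * y)); first by apply: hphi; apply: mulf_neq0.
  exact: (ZM _ _ (hphi _ x0) (hphi _ y0)).
- by move=> x x0; have [] := Zn _ (hphi _ x0).
- move=> x Gx; apply: (Zfun x); first by apply: hphi; have [] := GV _ Gx.
  by apply: Z0Z.
Qed.

End ExtensionOfCharacters.

(** * The valuation of F *)

Section Valuation.
Variables (F : fieldType) (v : local_valuation F).

Definition vge (m : int) (x : F) : Prop := (m%:E <= v x)%E.

Lemma vge0r m : vge m 0.
Proof. by rewrite /vge (proj2 (lval_eqy v 0) erefl) leey. Qed.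

(** The value -oo is excluded because it would propagate to v 0 = +oo. *)
Lemma val_int x : x != 0 -> exists k : int, v x = k%:E.
Proof.
move=> x0; case e: (v x) => [k| |]; first by exists k.
  by move/eqP: x0; case; apply/(lval_eqy v).
have e1 : v 1 = -oo%E by rewrite -(divff x0) lvalM e addNye.
have := proj2 (lval_eqy v 0) erefl.
by rewrite -(mul1r 0) lvalM e1 addNye.
Qed.

Lemma val1 : v 1 = 0%:E.
Proof.
have [k e] := val_int (oner_neq0 F).
have := lvalM v 1 1; rewrite mulr1 e -EFinD => -[ek]; congr _%:E; lia.
Qed.

Lemma valV x k : x != 0 -> v x = k%:E -> v x^-1 = (- k)%:E.
Proof.
move=> x0 ex; have [j ej] := val_int (invr_neq0 x0).
have := lvalM v x x^-1; rewrite divff // val1 ex ej -EFinD => -[e].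
by congr _%:E; lia.
Qed.

Lemma vgeW m m' x : m' <= m -> vge m x -> vge m' x.
Proof. by move=> le; apply: le_trans; rewrite lee_fin. Qed.

Lemma vgeD m x y : vge m x -> vge m y -> vge m (x + y).
Proof.
move=> hx hy; apply: le_trans (lvalD v x y).
by rewrite le_min; apply/andP; split.
Qed.

Lemma vgeM m m' x y : vge m x -> vge m' y -> vge (m + m') (x * y).
Proof. by move=> hx hy; rewrite /vge lvalM EFinD; apply: leeD. Qed.

Lemma vge1 : vge 0 1.
Proof. by rewrite /vge val1. Qed.

Lemma valN1 : v (-1) = 0%:E.
Proof.
have n1 : -1 != 0 :> F by rewrite oppr_eq0 oner_eq0.
have [k e] := val_int n1.
have := lvalM v (-1) (-1); rewrite mulrNN mulr1 e val1 -EFinD => -[ek].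
congr _%:E; lia.
Qed.

Lemma vgeN m x : vge m x -> vge m (- x).
Proof. by move=> h; rewrite -mulN1r -[m]add0r; apply: vgeM => //; rewrite /vge valN1. Qed.

Lemma vge_sum (I : Type) (r : seq I) (P : pred I) (f : I -> F) m :
  (forall i, vge m (f i)) -> vge m (\sum_(i <- r | P i) f i).
Proof.
move=> h; elim/big_rec: _ => [|i x _ hx]; first exact: vge0r.
exact: vgeD.
Qed.

Lemma vgeX m x n : vge m x -> vge (m * n%:Z) (x ^+ n).
Proof.
move=> h; elim: n => [|n IH]; first by rewrite mulr0 expr0; apply: vge1.
rewrite exprS (_ : m * _ = m + m * n%:Z); last by lia.
exact: vgeM.
Qed.

Lemma vge_lower x : exists m, vge m x.
Proof.
have [->|x0] := eqVneq x 0; first by exists 0; apply: vge0r.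
by have [k e] := val_int x0; exists k; rewrite /vge e.
Qed.

Lemma vge_lower_fin (I : finType) (f : I -> F) : exists m, forall i, vge m (f i).
Proof.
have [m hm] := choice (fun i => vge_lower (f i)).
exists (- (\sum_i `|m i|%N)%:Z) => i; apply: vgeW (hm i).
rewrite (bigD1 i) //=; lia.
Qed.

Lemma vge_unbounded x : (forall m, vge m x) -> x = 0.
Proof.
move=> h; apply/eqP; apply/negPn/negP => /val_int [k e].
have := h (k + 1); rewrite /vge e lee_fin; lia.
Qed.

Lemma uniformizer : exists2 w : F, w != 0 & v w = 1%:E.
Proof.
have [w e] := lval_uniformizer v; exists w => //.
by apply/eqP=> w0; have := proj2 (lval_eqy v w) w0; rewrite e.
Qed.

Lemma pow_uniformizer (m : int) : exists2 c : F, c != 0 & v c = m%:E.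
Proof.
have [w w0 e] := uniformizer.
have hn n : v (w ^+ n) = n%:Z%:E.
  elim: n => [|n IH]; first by rewrite expr0 val1.
  by rewrite exprS lvalM e IH -EFinD; congr _%:E; lia.
case: m => n; first by exists (w ^+ n); rewrite ?expf_neq0.
exists (w ^+ n.+1)^-1; first by rewrite invr_neq0 // expf_neq0.
by rewrite (valV _ (hn _)) ?expf_neq0.
Qed.

(** The valuation ring is integrally closed: an integral equation, divided by
    x ^ n, expresses x by nonpositive powers of itself. *)
Lemma vge_integral (p : {poly F}) x : p \is monic -> (forall i, vge 0 p`_i) ->
  \sum_(i < size p) p`_i * x ^+ i = 0 -> vge 0 x.
Proof.
move=> mp hp ex; have [->|x0] := eqVneq x 0; first exact: vge0r.
have [k ek] := val_int x0.
rewrite /vge ek lee_fin leNgt; apply/negP => k0.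
have sp : (0 < size p)%N by rewrite size_poly_gt0 monic_neq0.
have : vge 0 x.
  case es : (size p) sp ex => [//|n] _.
  rewrite big_ord_recr /=.
  have -> : p`_n = 1 by move/monicP: mp; rewrite /lead_coef es.
  rewrite mul1r => /eqP; rewrite addrC addr_eq0 => /eqP e.
  case: n es e => [|n] es e.
    by move: e; rewrite big_ord0 oppr0 expr0 => /eqP; rewrite oner_eq0.
  have -> : x = x ^+ n.+1 * (x ^+ n)^-1 by rewrite exprS mulfK // expf_neq0.
  rewrite e mulNr; apply: vgeN; rewrite mulr_suml; apply: vge_sum => i.
  have -> : p`_i * x ^+ i / x ^+ n = p`_i * x^-1 ^+ (n - i).
    rewrite -mulrA; congr (_ * _); have li : (i <= n)%N by have := ltn_ord i.
    have -> : x ^+ n = x ^+ (n - i) * x ^+ i by rewrite -exprD subnK.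
    by rewrite invfM mulrCA divff ?expf_neq0 // mulr1 exprVn.
  rewrite -[0]addr0; apply: vgeM; first exact: hp.
  apply: vgeW (vgeX _ (m := - k) _); first by rewrite mulr_ge0 //; lia.
  by rewrite /vge (valV x0 ek).
by rewrite /vge ek lee_fin; lia.
Qed.

End Valuation.

(** * Endomorphisms, scalars and neighbourhoods of zero *)

Section Endomorphisms.
Variables (F : fieldType) (V : vectType F).
Local Notation A := 'End(V).
Implicit Types (x y : A) (c : F).

Lemma end_mulE x y w : (x * y : A) w = x (y w).
Proof. exact: comp_lfunE. Qed.

Lemma end_oneE w : (1 : A) w = w.
Proof. exact: id_lfunE. Qed.

Lemma end_scaleE c x w : (c *: x : A) w = c *: x w.
Proof. exact: scale_lfunE. Qed.

Lemma end_addE x y w : (x + y : A) w = x w + y w.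
Proof. exact: add_lfunE. Qed.

Lemma end_subE x y w : (x - y : A) w = x w - y w.
Proof. by rewrite add_lfunE opp_lfunE. Qed.

Lemma end_sumE (I : Type) (r : seq I) (P : pred I) (f : I -> A) w :
  (\sum_(i <- r | P i) f i) w = \sum_(i <- r | P i) f i w.
Proof. exact: sum_lfunE. Qed.

Lemma end_scaleAl c x y : (c *: x) * y = c *: (x * y).
Proof. by apply/lfunP=> w; rewrite !(end_mulE, end_scaleE). Qed.

Lemma end_scaleAr c x y : x * (c *: y) = c *: (x * y).
Proof. by apply/lfunP=> w; rewrite !(end_mulE, end_scaleE) linearZ. Qed.

Lemma scalar_exp c n : (c *: (1 : A)) ^+ n = c ^+ n *: (1 : A).
Proof.
elim: n => [|n IH]; first by rewrite !expr0 scale1r.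
by rewrite !exprS IH end_scaleAl mul1r scalerA.
Qed.

(** Finite dimension makes one-sided inverses two-sided. *)
Lemma end_mul1C x y : x * y = 1 -> y * x = 1.
Proof.
move=> xy; have injy : lker y == 0%VS.
  apply/lker0P=> a b e; have := congr1 x e.
  by rewrite -!end_mulE xy !end_oneE.
apply/lfunP=> w; rewrite end_oneE.
have : w \in limg y by rewrite (lker0_limgf injy) memvf.
by case/memv_imgP=> u _ ->; rewrite end_mulE -[x _]end_mulE xy end_oneE.
Qed.

Lemma end_injective_unit x : (forall w, x w = 0 -> w = 0) -> exists y, x * y = 1 /\ y * x = 1.
Proof.
move=> inj; have k0 : lker x == 0%VS.
  apply/lker0P=> a b e; apply/eqP; rewrite -subr_eq0; apply/eqP; apply: inj.
  by rewrite linearB /= e subrr.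
have yx : (x^-1)%VF * x = 1 by apply: lker0_compVf.
by exists (x^-1)%VF; split=> //; apply: end_mul1C.
Qed.

Lemma linear_end (f : V -> V) :
  (forall a u w, f (a *: u + w) = a *: f u + f w) -> exists x : A, forall w, x w = f w.
Proof.
move=> lf; pose f' : {linear V -> V} := HB.pack f (GRing.isLinear.Build _ _ _ _ f lf).
by exists (linfun f') => w; rewrite lfunE.
Qed.

Lemma end_over_scalar x : End_over (scalar_field V) x.
Proof. by move=> _ [c _ <-]; rewrite end_scaleAl end_scaleAr mul1r mulr1. Qed.

Lemma end_overM (K : set A) x y : End_over K x -> End_over K y -> End_over K (x * y).
Proof. by move=> hx hy a Ka; rewrite -mulrA hy // !mulrA hx. Qed.

Lemma end_overD (K : set A) x y : End_over K x -> End_over K y -> End_over K (x + y).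
Proof. by move=> hx hy a Ka; rewrite mulrDl mulrDr hx // hy. Qed.

Lemma end_overN (K : set A) x : End_over K x -> End_over K (- x).
Proof. by move=> hx a Ka; rewrite mulNr mulrN hx. Qed.

Lemma end_over1 (K : set A) : End_over K 1.
Proof. by move=> a Ka; rewrite mul1r mulr1. Qed.

Lemma end_overV (K : set A) x y : End_over K x -> x * y = 1 -> End_over K y.
Proof.
move=> hx xy a Ka; have yx := end_mul1C xy.
have <- : y * (x * a) * y = a * y by rewrite mulrA yx mul1r.
by rewrite hx // -!mulrA xy mulr1.
Qed.

End Endomorphisms.

Section Lattices.
Variables (F : fieldType) (v : local_valuation F) (V : vectType F).
Local Notation A := 'End(V).
Hypothesis A_neq0 : (1 : A) <> 0.
Implicit Types (x y : A) (c : F).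

Lemma scalar_inj c d : c *: (1 : A) = d *: (1 : A) -> c = d.
Proof.
move=> e; apply/eqP; rewrite -subr_eq0; apply/negPn/negP => cd.
apply: A_neq0; apply: (scalerI cd).
by rewrite scaler0 scalerBl e subrr.
Qed.

Lemma integers_scalar x :
  integers v (scalar_field V) x <-> exists2 c, vge v 0 c & x = c *: (1 : A).
Proof.
split=> [[[c _ <-] [p [mp hp e]]]|[c hc ->]].
  exists c => //; apply: (vge_integral mp hp).
  apply: scalar_inj; rewrite scale0r -[RHS]e scaler_suml.
  by apply: eq_bigr => i _; rewrite scalar_exp scalerA.
split; first by exists c.
exists ('X - c%:P); split; first exact: monicXsubC.
  move=> i; rewrite coefB coefX coefC; apply: vgeD; last apply: vgeN.
    by case: (i == 1)%N; [apply: vge1|apply: vge0r].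
  by case: (i == 0)%N => //; apply: vge0r.
rewrite size_XsubC !big_ord_recr big_ord0 /= !coefB !coefX !coefC /=.
by rewrite add0r sub0r subr0 expr0 expr1 scale1r scaleNr addNr.
Qed.

Lemma max_ideal_scalar x :
  max_ideal v (scalar_field V) x <-> exists2 c, vge v 1 c & x = c *: (1 : A).
Proof.
split=> [[/integers_scalar [c hc ->] nu]|[c hc ->]].
  exists c => //; have [->|c0] := eqVneq c 0; first exact: vge0r.
  have [k ek] := val_int v c0.
  rewrite /vge ek lee_fin leNgt; apply/negP => k1; apply: nu.
  move: hc; rewrite /vge ek lee_fin => k0.
  have k00 : k = 0 by lia.
  split; first by apply/integers_scalar; exists c => //; rewrite /vge ek k00.
  exists (c^-1 *: (1 : A)).
    by apply/integers_scalar; exists c^-1; rewrite // /vge (valV c0 ek) k00.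
  by rewrite !end_scaleAl !mul1r !scalerA divff // mulVf // scale1r.
split; first by apply/integers_scalar; exists c => //; apply: vgeW hc.
move=> [_ [_ /integers_scalar [d hd ->]]]; rewrite end_scaleAl mul1r scalerA.
move=> [e _]; have : vge v (1 + 0) (c * d) by apply: vgeM.
rewrite (_ : c * d = 1); last by apply: scalar_inj; rewrite e scale1r.
by rewrite /vge val1 addr0.
Qed.

Local Notation bA := (vbasis {:A}).

(** The fractional multiples of the lattice spanned by a fixed basis of A are a
    base of neighbourhoods of zero, with which intersections are easier to
    handle than with arbitrary lattices. *)
Definition is_nbhd (U : set A) : Prop :=
  exists N : int, forall x, (forall i, vge v N (coord bA i x)) -> U x.

Lemma nbhdW (U U' : set A) : U `<=` U' -> is_nbhd U -> is_nbhd U'.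
Proof. by move=> UU' [N h]; exists N => x /h /UU'. Qed.

Lemma nbhdI (U U' : set A) : is_nbhd U -> is_nbhd U' -> is_nbhd (U `&` U').
Proof.
move=> [N h] [N' h']; exists (Num.max N N') => x hx; split.
  by apply: h => i; apply: vgeW (hx i); rewrite le_max lexx.
by apply: h' => i; apply: vgeW (hx i); rewrite le_max lexx orbT.
Qed.

Lemma coordE x : x = \sum_i coord bA i x *: bA`_i.
Proof. by rewrite -coord_vbasis // memvf. Qed.

Lemma nbhd_mulr (U : set A) e : is_nbhd U -> is_nbhd [set z | U (z * e)].
Proof.
move=> [N h].
have [m hm] := vge_lower_fin v (fun ij => coord bA ij.1 (bA`_(ij.2 : 'I_(\dim {:A})) * e)).
exists (N - m) => x hx; apply: h => i.
rewrite {1}(coordE x) mulr_suml linear_sum; apply: vge_sum => j.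
rewrite end_scaleAl linearZ /= -(subrK m N); apply: vgeM => //.
exact: (hm (i, j)).
Qed.

Lemma lattice_nbhd (L : set A) : is_lattice v *%R (scalar_field V) [set: A] L -> is_nbhd L.
Proof.
move=> [t [<- spans]].
have e j : exists f : nat -> F, bA`_(j : 'I_(\dim {:A})) = \sum_(i < size t) f i *: t`_i.
  have [a ha ->] : combinations *%R (scalar_field V) t bA`_j by rewrite spans.
  have [f hf] := choice (fun i => (let: ex_intro2 c _ e := ha i in ex_intro _ c e)).
  by exists f; apply: eq_bigr => i _; rewrite -hf end_scaleAl mul1r.
have [f hf] := choice e.
have [m hm] := vge_lower_fin v (fun ij => f ij.1 (ij.2 : 'I_(size t))).
exists (- m) => x hx.
exists (fun i => (\sum_j coord bA j x * (if (i < size t)%N then f j i else 0)) *: (1 : A)).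
  move=> i; apply/integers_scalar; eexists; last reflexivity.
  apply: vge_sum => j; rewrite -(addNr m); apply: vgeM => //.
  case: ifP => hi; last exact: vge0r.
  exact: (hm (j, Ordinal hi)).
rewrite {1}(coordE x).
under eq_bigr => j _ do rewrite hf scaler_sumr.
rewrite exchange_big /=; apply: eq_bigr => i _.
rewrite ltn_ord end_scaleAl mul1r scaler_suml.
by apply: eq_bigr => j _; rewrite scalerA.
Qed.

Lemma nbhd_lattice (U : set A) : is_nbhd U ->
  exists2 L, is_lattice v *%R (scalar_field V) [set: A] L & L `<=` U.
Proof.
move=> [N h]; have [c c0 ec] := pow_uniformizer v N.
pose t := [seq c *: e | e <- bA].
have st : size t = \dim {:A} by rewrite size_map size_tuple.
have et i : (i < \dim {:A})%N -> t`_i = c *: bA`_i.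
  by move=> hi; rewrite (nth_map 0) // size_tuple.
exists (combinations *%R (integers v (scalar_field V)) t).
  exists t; split=> //; apply/seteqP; split=> // x _.
  exists (fun i => (if insub i is Some j then coord bA j x / c else 0) *: (1 : A)).
    by move=> i; eexists.
  rewrite st {1}(coordE x); apply: eq_bigr => i _.
  by rewrite valK end_scaleAl mul1r et // scalerA divfK.
move=> _ [a ha ->]; apply: h => i.
have [f hf] := choice (fun i => (let: ex_intro2 c vc e := proj1 (integers_scalar (a i)) (ha i) in
   ex_intro (fun c => vge v 0 c /\ a i = c *: (1 : A)) c (conj vc e))).
rewrite st (_ : \sum_(_ < _) _ = \sum_(j < \dim {:A}) (f j * c) *: bA`_j).
  rewrite coord_sum_free ?(basis_free (vbasisP _)) //.
  by rewrite -[N]add0r; apply: vgeM; [case: (hf i)|rewrite /vge ec].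
apply: eq_bigr => j _; rewrite (proj2 (hf j)) end_scaleAl mul1r et // scalerA //.
Qed.

End Lattices.

(** * Lattice chains *)

Lemma max_vspace (F : fieldType) (V : vectType F) (P : {vspace V} -> Prop) U0 : P U0 ->
  exists2 U, P U & forall U', P U' -> (\dim U' <= \dim U)%N.
Proof.
move=> PU0; pose Q d := `[< exists2 U, P U & \dim U = d >].
have exQ : exists d, Q d by exists (\dim U0); apply/asboolP; exists U0.
have bQ d : Q d -> (d <= \dim {:V})%N by move=> /asboolP [U _ <-]; rewrite dimvS ?subvf.
have [d /asboolP [U PU <-] maxd] := ex_maxnP exQ bQ.
by exists U => // U' PU'; apply: maxd; apply/asboolP; exists U'.
Qed.

(** A subspace of maximal dimension among those contained in X exhausts X. *)
Lemma set_vspace (F : fieldType) (V : vectType F) (X : set V) : X 0 ->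
  (forall c u w, X u -> X w -> X (c *: u + w)) ->
  exists U : {vspace V}, forall w, X w <-> w \in U.
Proof.
move=> X0 XD.
have XA u w : X u -> X w -> X (u + w) by move=> Xu; rewrite -[u]scale1r; apply: XD.
have XZ c u : X u -> X (c *: u) by move=> Xu; rewrite -[_ *: _]addr0; apply: XD.
have [|U XU maxU] := @max_vspace _ V (fun U => forall w, w \in U -> X w) 0%VS.
  by move=> w; rewrite memv0 => /eqP ->.
exists U => w; split=> [Xw|]; last exact: XU.
have /dimv_leqif_sup : (U <= U + <[w]>)%VS by apply: addvSl.
have le : (\dim (U + <[w]>) <= \dim U)%N.
  apply: maxU => z /memv_addP [u Uu [z' /vlineP [c ->] ->]].
  by apply: XA; [exact: XU|exact: XZ].
move=> [] + /esym; rewrite eqn_leq le andbT => -> /subvP; apply.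
by apply: (subvP (addvSr _ _)); apply: memv_line.
Qed.

Lemma int_max (P : int -> Prop) i0 m : P i0 -> (forall i, P i -> i <= m) ->
  exists2 i, P i & forall j, P j -> j <= i.
Proof.
move=> Pi0 bP; pose Q n := `[< P (i0 + n%:Z) >].
have exQ : exists n, Q n by exists 0%N; apply/asboolP; rewrite addr0.
have bQ n : Q n -> (n <= `|m - i0|)%N by move=> /asboolP /bP; lia.
have [n /asboolP Pn maxn] := ex_maxnP exQ bQ.
exists (i0 + n%:Z) => // j Pj.
have [le|lt] := lerP j i0; first lia.
have : (`|j - i0| <= n)%N by apply: maxn; apply/asboolP; rewrite (_ : _ + _ = j) //; lia.
lia.
Qed.

Section Chains.
Variables (F : fieldType) (v : local_valuation F) (V : vectType F) (L : int -> set V).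
Local Notation A := 'End(V).
Hypothesis A_neq0 : (1 : A) <> 0.
Hypothesis hL : lattice_chain v (scalar_field V) L.
Implicit Types (x y : A).

Lemma chain_generators i : exists t : seq V,
  (forall w, L i w <-> exists2 c : nat -> F, (forall j, vge v 0 (c j))
                      & w = \sum_(j < size t) c j *: t`_j) /\
  (forall w, exists c : nat -> F, w = \sum_(j < size t) c j *: t`_j).
Proof.
have [/(_ i) [t [<- spans]] _ _] := hL; exists t; split=> w.
  split=> [[a ha ->]|[c hc ->]].
    have [f hf] := choice (fun i => (let: ex_intro2 c vc e :=
      proj1 (integers_scalar v A_neq0 (a i)) (ha i) in
      ex_intro (fun c => vge v 0 c /\ a i = c *: (1 : A)) c (conj vc e))).
    exists f; first by move=> j; case: (hf j).
    by apply: eq_bigr => j _; rewrite (proj2 (hf j)) /evalV end_scaleE end_oneE.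
  exists (fun j => c j *: (1 : A)).
    by move=> j; apply/(integers_scalar v A_neq0); exists (c j).
  by apply: eq_bigr => j _; rewrite /evalV end_scaleE end_oneE.
have : [set: V] w by [].
rewrite -spans => -[a ha ->].
have [f hf] := choice (fun i => (let: ex_intro2 c _ e := ha i in ex_intro _ c e)).
by exists f; apply: eq_bigr => j _; rewrite -hf /evalV end_scaleE end_oneE.
Qed.

Lemma chain0 i : L i 0.
Proof.
have [t [tL _]] := chain_generators i; apply/tL.
exists (fun _ => 0); first by move=> _; apply: vge0r.
by rewrite big1 // => j _; rewrite scale0r.
Qed.

Lemma chainD i u w : L i u -> L i w -> L i (u + w).
Proof.
have [t [tL _]] := chain_generators i => /tL [c hc ->] /tL [d hd ->]; apply/tL.
exists (fun j => c j + d j); first by move=> j; apply: vgeD.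
by rewrite -big_split; apply: eq_bigr => j _; rewrite scalerDl.
Qed.

Lemma chainZ i c w : vge v 0 c -> L i w -> L i (c *: w).
Proof.
have [t [tL _]] := chain_generators i => hc /tL [d hd ->]; apply/tL.
exists (fun j => c * d j); first by move=> j; rewrite -[0]addr0; apply: vgeM.
by rewrite scaler_sumr; apply: eq_bigr => j _; rewrite scalerA.
Qed.

Lemma chainN i w : L i w -> L i (- w).
Proof.
by move=> Lw; rewrite -scaleN1r; apply: chainZ => //; apply: vgeN; apply: vge1.
Qed.

Lemma chainB i u w : L i u -> L i w -> L i (u - w).
Proof. by move=> Lu Lw; apply: chainD => //; apply: chainN. Qed.

Lemma chain_sum i (I : Type) (r : seq I) (P : pred I) (f : I -> V) :
  (forall k, L i (f k)) -> L i (\sum_(k <- r | P k) f k).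
Proof.
by move=> h; elim/big_rec: _ => [|k x _ hx]; [exact: chain0|exact: chainD].
Qed.

Lemma chain_le i j : i <= j -> L j `<=` L i.
Proof.
have [_ dec _] := hL.
move=> ij; rewrite (_ : j = i + `|j - i|%N%:Z); last by lia.
elim: `|_|%N => [|n IH]; first by rewrite addr0.
apply: subset_trans IH; rewrite (_ : i + n.+1%:Z = i + n%:Z + 1); last by lia.
by have [] := dec (i + n%:Z).
Qed.

Lemma chain_strict i : exists2 w, L i w & ~ L (i + 1) w.
Proof.
have [_ /(_ i) [_ ns] _] := hL; apply/not_exists2P => h; apply: ns => w Lw.
by case: (h w) => // /contrapT.
Qed.

(** The period e of the chain is by definition the shift due to the maximal
    ideal, which a uniformizer generates. *)
Lemma chain_scale : exists2 e : int, 0 < e & forall c k, v c = k%:E ->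
  forall i w, L i w <-> L (i + e * k) (c *: w).
Proof.
have [_ _ [e e0 he]] := hL; exists e%:Z => //.
have fwd c i w : vge v 1 c -> L i w -> L (i + e%:Z) (c *: w).
  move=> hc Lw; rewrite he; exists [:: (c *: (1 : A), w)].
    move=> p; rewrite inE => /eqP -> /=; split=> //.
    by apply/(max_ideal_scalar v A_neq0); exists c.
  by rewrite big_seq1 /evalV end_scaleE end_oneE.
have bwd c i w : v c = 1%:E -> L (i + e%:Z) (c *: w) -> L i w.
  move=> ec; have c0 : c != 0.
    by apply/eqP => /(lval_eqy v); rewrite ec.
  rewrite he => -[t ht eq]; rewrite -[w]scale1r -(mulVf c0) -scalerA eq.
  rewrite scaler_sumr big_seq_cond; apply: big_ind => [| |p].
  - exact: chain0.
  - by move=> ? ?; apply: chainD.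
  - rewrite andbT => /ht [/(max_ideal_scalar v A_neq0) [d hd ->] Lp].
    rewrite /evalV end_scaleE end_oneE scalerA; apply: chainZ => //.
    rewrite -(addNr 1); apply: vgeM => //.
    by rewrite /vge (valV c0 ec).
have [p p0 ep] := uniformizer v.
have pE i w : L i w <-> L (i + e%:Z) (p *: w).
  by split; [apply: fwd; rewrite /vge ep|apply: bwd].
have ppow n i w : L i w <-> L (i + e%:Z * n%:Z) (p ^+ n *: w).
  elim: n i w => [|n IH] i w; first by rewrite mulr0 addr0 expr0 scale1r.
  rewrite (_ : i + _ = (i + e%:Z) + e%:Z * n%:Z); last by lia.
  by rewrite exprSr -scalerA -IH; apply: pE.
have unit c i w : v c = 0%:E -> L i w <-> L i (c *: w).
  move=> ec; have c0 : c != 0.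
    by apply/eqP => /(lval_eqy v); rewrite ec.
  split; first by apply: chainZ; rewrite /vge ec.
  move=> Lcw; rewrite -[w]scale1r -(mulVf c0) -scalerA; apply: chainZ => //.
  by rewrite /vge (valV c0 ec) oppr0.
have vp n : v (p ^+ n) = n%:Z%:E.
  elim: n => [|n IH]; first by rewrite expr0 val1.
  by rewrite exprS lvalM ep IH -EFinD; congr _%:E; lia.
move=> c k ec i w.
have c0 : c != 0 by apply/eqP => /(lval_eqy v); rewrite ec.
case: k ec => n ec.
  have pn : p ^+ n != 0 by rewrite expf_neq0.
  have eu : v (c / p ^+ n) = 0%:E.
    by rewrite lvalM ec (valV pn (vp n)) -EFinD; congr _%:E; lia.
  by rewrite (ppow n) (unit _ _ _ eu) scalerA divfK.
have eu : v (p ^+ n.+1 * c) = 0%:E.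
  by rewrite lvalM ec vp -EFinD; congr _%:E; lia.
rewrite (unit _ _ _ eu) (ppow n.+1 (i + _)) scalerA.
by rewrite (_ : i + _ + _ = i) //; lia.
Qed.

Lemma chain_exhaust w : exists i, L i w.
Proof.
have [e e0 he] := chain_scale.
have [t [tL spans]] := chain_generators 0; have [c ->] := spans w.
have [m hm] := vge_lower_fin v (fun j : 'I_(size t) => c j).
have [d d0 ed] := pow_uniformizer v m.
exists (0 + e * m).
rewrite (_ : \sum_(j < _) _ = d *: \sum_(j < size t) (c j / d) *: t`_j); last first.
  by rewrite scaler_sumr; apply: eq_bigr => j _; rewrite scalerA mulrC divfK.
apply/(proj1 (he _ _ ed _ _)); apply/tL.
exists (fun j => if (j < size t)%N then c j / d else 0).
  move=> j; case: ifP => [lt|_]; last exact: vge0r.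
  rewrite -(addrN m); apply: vgeM; first exact: (hm (Ordinal lt)).
  by rewrite /vge (valV d0 ed).
by apply: eq_bigr => j _; rewrite ltn_ord.
Qed.

(** Each coordinate is bounded on L 0, hence tends to 0 along the chain. *)
Lemma chain_separated w : (forall i, L i w) -> w = 0.
Proof.
have [e e0 he] := chain_scale.
have [t [tL spans]] := chain_generators 0 => Lw.
rewrite (coord_vbasis (memvf w)) big1 // => k _.
rewrite [coord _ _ _](_ : _ = 0) ?scale0r //.
have [m hm] := vge_lower_fin v (fun j : 'I_(size t) => coord (vbasis {:V}) k t`_j).
apply: (@vge_unbounded _ v) => q.
have [d d0 ed] := pow_uniformizer v (q - m).
have : L (0 + e * (q - m)) w by apply: Lw.
have -> : w = d *: (d^-1 *: w) by rewrite scalerA divff ?scale1r.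
move/(proj2 (he _ _ ed _ _))/tL => [c hc ->].
rewrite linearZ linear_sum /= -(subrK m q); apply: vgeM; first by rewrite /vge ed.
apply: vge_sum => j; rewrite linearZ /= -[m]add0r; apply: vgeM => //.
Qed.

(** The lattice L 0 is finitely generated, so x moves it by a bounded amount;
    periodicity gives the same bound, up to a period, for the whole chain. *)
Lemma chain_bounded x : exists q, forall i w, L i w -> L (i + q) (x w).
Proof.
have [e e0 he] := chain_scale.
have [t [tL spans]] := chain_generators 0.
have [f hf] := choice (fun j : 'I_(size t) => chain_exhaust (x t`_j)).
pose q0 := - (\sum_j `|f j|%N)%:Z.
have h0 w : L 0 w -> L q0 (x w).
  move/tL => [c hc ->]; rewrite linear_sum; apply: chain_sum => j.
  rewrite linearZ; apply: chainZ => //; apply: chain_le (hf j).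
  by rewrite /q0 (bigD1 j) //=; lia.
exists (q0 - e) => i w Lw.
have ei := divz_eq i e; have r0 := modz_ge0 i (lt0r_neq0 e0).
have re := ltz_pmod i e0.
have [d d0 ed] := pow_uniformizer v (i %/ e)%Z.
have ew : w = d *: (d^-1 *: w) by rewrite scalerA divff ?scale1r.
have : L (0 + e * (i %/ e)%Z) w by apply: chain_le Lw; lia.
have -> : x w = d *: x (d^-1 *: w) by rewrite -linearZ -ew.
rewrite {1}ew => /(proj2 (he _ _ ed _ _))/h0/(proj1 (he _ _ ed _ _)).
apply: chain_le; lia.
Qed.

(** A lattice chain is closed for the topology it defines: a subspace avoids a
    small neighbourhood of any point outside it.  The projection along the
    subspace reduces this to separatedness. *)
Lemma chain_closed (U : {vspace V}) u : u \notin U ->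
  exists q, forall z, z \in U -> ~ L q (u + z).
Proof.
move=> uU; pose T : A := 1 - projv U.
have TU z : z \in U -> T z = 0.
  by move=> zU; rewrite end_subE end_oneE projv_id // subrr.
have Tu : T u != 0.
  apply: contraNneq uU; rewrite end_subE end_oneE => /eqP; rewrite subr_eq0 => /eqP ->.
  exact: memv_proj.
have [q hq] := chain_bounded T.
have [j nj] : exists j, ~ L j (T u).
  apply/not_existsP => h; move/eqP: Tu; apply; apply: chain_separated => j.
  by apply: contrapT; apply: h.
exists (j - q) => z zU /hq; rewrite subrK linearD /= (TU z zU) addr0.
exact: nj.
Qed.

End Chains.

(** * Subfields of End(V) and rank one operators over them *)

Section Subfields.
Variables (F : fieldType) (V : vectType F) (K : set 'End(V)).
Hypothesis hK : is_subfield K.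
Implicit Types x y : 'End(V).

Lemma subfield1 : K 1.
Proof. by case: hK => _ [? _]. Qed.

Lemma subfieldB x y : K x -> K y -> K (x - y).
Proof. by case: hK => _ [_ h] _ _ Kx Ky; case: (h x y Kx Ky). Qed.

Lemma subfieldM x y : K x -> K y -> K (x * y).
Proof. by case: hK => _ [_ h] _ _ Kx Ky; case: (h x y Kx Ky). Qed.

Lemma subfield0 : K 0.
Proof. by rewrite -(subrr 1); apply: subfieldB; apply: subfield1. Qed.

Lemma subfieldN x : K x -> K (- x).
Proof. by rewrite -sub0r; apply: subfieldB; apply: subfield0. Qed.

Lemma subfieldD x y : K x -> K y -> K (x + y).
Proof. by move=> Kx Ky; rewrite -[y]opprK; apply: subfieldB => //; apply: subfieldN. Qed.

Lemma subfieldC x y : K x -> K y -> x * y = y * x.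
Proof. by case: hK => _ _ h _; apply: h. Qed.

Lemma subfieldV x : K x -> x <> 0 -> exists y, [/\ K y, y <> 0, x * y = 1 & y * x = 1].
Proof.
case: hK => A0 _ _ h Kx x0; have [_ [y Ky [xy yx]]] := h x Kx x0.
exists y; split=> // y0; apply: A0; by rewrite -xy y0 mulr0.
Qed.

Lemma subfield_neq0 : (1 : 'End(V)) <> 0.
Proof. by case: hK. Qed.

Lemma subfield_units x : K x -> x <> 0 -> units_of K x.
Proof. by case: hK => _ _ _; apply. Qed.

End Subfields.

Lemma scalar_subfield (F : fieldType) (V : vectType F) :
  (1 : 'End(V)) <> 0 -> is_subfield (scalar_field V).
Proof.
move=> A0; split=> //.
- split; first by exists 1; rewrite ?scale1r.
  move=> _ _ [c _ <-] [d _ <-]; split.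
    by exists (c - d); rewrite ?scalerBl.
  by exists (c * d); rewrite // end_scaleAl mul1r scalerA.
- by move=> _ _ [c _ <-] [d _ <-]; rewrite !end_scaleAl !mul1r !scalerA mulrC.
- move=> _ [c _ <-] c0; split; first by exists c.
  have {}c0 : c != 0 by apply/eqP => e; apply: c0; rewrite e scale0r.
  exists (c^-1 *: (1 : 'End(V))); first by exists c^-1.
  by rewrite !end_scaleAl !mul1r !scalerA divff // mulVf // scale1r.
Qed.

Section ChainElements.
Variables (F : fieldType) (v : local_valuation F) (V : vectType F) (L : int -> set V).
Local Notation A := 'End(V).
Hypothesis A_neq0 : (1 : A) <> 0.
Hypothesis hL : lattice_chain v (scalar_field V) L.
Implicit Types (x : A).

Definition shifts_chain (g : A) (k : int) : Prop :=
  forall i w, L i w <-> L (i + k) (g w).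

(** The operator is y |-> f y u for a K-linear functional f with f w = 1 such that
    f y shifts the chain by at least the level of y minus i.  It is the
    projection along a K-subspace W such that w + z is outside L (i + 1) for all
    z in W, and any maximal W with this property is a complement of K w.
    Otherwise take y outside K w + W, and y0 in y + K w + W of the highest
    possible level; it exists since subspaces are closed.  By maximality of W
    some w + z + a y0 lies in L (i + 1), with a <> 0.  Dividing by a, the choice
    of y0 forces a y0, hence also w + z, to lie in L (i + 1): a contradiction. *)
Lemma chain_rank_one (K : set A) i w u : is_subfield K -> scalar_field V `<=` K ->
  (forall g, K g -> g <> 0 -> exists k, shifts_chain g k) ->
  L i w -> ~ L (i + 1) w -> L i u ->
  exists x, [/\ End_over K x, forall j z, L j z -> L j (x z) & x w = u].
Proof.
move=> hK FK Kshift Lw nLw Lu.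
have KZ (c : F) : K (c *: (1 : A)) by apply: FK; exists c.
have scE (c : F) z : c *: z = (c *: (1 : A)) z by rewrite end_scaleE end_oneE.
have [|W [WK Wdist] maxW] := @max_vspace _ V (fun W =>
    (forall a z, K a -> z \in W -> a z \in W) /\
    (forall z, z \in W -> ~ L (i + 1) (w + z))) 0%VS.
  split=> [a z _|z]; rewrite memv0 => /eqP ->.
    by rewrite linear0 mem0v.
  by rewrite addr0.
have span (y : V) : exists a z, [/\ K a, z \in W & y = a w + z].
  apply/not_notP => ny.
  have [||U hU] := @set_vspace _ V [set y' : V | exists (a : A) (z : V), [/\ K a, z \in W & y' = a w + z]].
  - exists 0, 0; split; [exact: subfield0|exact: mem0v|].
    by rewrite zero_lfunE addr0.
  - move=> c _ _ [a [z [Ka Wz ->]]] [a' [z' [Ka' Wz' ->]]].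
    exists (c *: (1 : A) * a + a'), (c *: z + z'); split.
    + by apply: subfieldD => //; apply: subfieldM.
    + by rewrite memvD ?memvZ.
    + by rewrite scalerDr end_addE end_mulE -scE addrACA.
  have yU : y \notin U by apply/negP => /hU.
  have [q hq] := chain_closed A_neq0 hL yU.
  have [j0 Lj0] := chain_exhaust A_neq0 hL y.
  have [| |N0 [b [z0 [Kb Wz0 Ly0]]] maxN] :=
    @int_max (fun j => exists b z, [/\ K b, z \in W & L j (y + (b w + z))]) j0 q.
  - exists 0, 0; split; [exact: subfield0|exact: mem0v|].
    by rewrite zero_lfunE !addr0.
  - move=> j [b [z [Kb Wz Lj]]]; rewrite leNgt; apply/negP => qj.
    apply: (hq (b w + z)); first by apply/hU; exists b, z.
    by apply: (chain_le hL _ Lj); apply: ltW.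
  set y0 := y + (b w + z0) in Ly0.
  have ny0 : y0 \notin W.
    apply/negP => Wy0; apply: ny; exists (- b), (y0 - z0); split.
    - exact: subfieldN.
    - by rewrite memvB.
    - by rewrite opp_lfunE /y0 !addrA addrK addrAC addNr add0r.
  have [||W' hW'] := @set_vspace _ V [set y' : V | exists (a : A) (z : V), [/\ K a, z \in W & y' = z + a y0]].
  - exists 0, 0; split; [exact: subfield0|exact: mem0v|].
    by rewrite zero_lfunE addr0.
  - move=> c _ _ [a [z [Ka Wz ->]]] [a' [z' [Ka' Wz' ->]]].
    exists (c *: (1 : A) * a + a'), (c *: z + z'); split.
    + by apply: subfieldD => //; apply: subfieldM.
    + by rewrite memvD ?memvZ.
    + by rewrite scalerDr end_addE end_mulE -scE addrACA.
  have WW' : (W <= W')%VS.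
    apply/subvP => z Wz; apply/hW'; exists 0, z; split=> //; first exact: subfield0.
    by rewrite zero_lfunE addr0.
  have [W'K|] := pselect (forall z, z \in W' -> ~ L (i + 1) (w + z)).
    have le : (\dim W' <= \dim W)%N.
      apply: maxW; split=> // a z Ka /hW' [a' [z' [Ka' Wz' ->]]]; apply/hW'.
      exists (a * a'), (a z'); split; [exact: subfieldM|exact: WK|].
      by rewrite linearD end_mulE.
    have [le' ] := dimv_leqif_sup WW'; rewrite eqn_leq le le' => /esym /subvP sub.
    move/negP: ny0; apply; apply: sub; apply/hW'; exists 1, 0; split; first exact: subfield1.
      exact: mem0v.
    by rewrite end_oneE add0r.
  apply=> z' /hW' [a [z [Ka Wz ->]]].
  have [a0|/eqP a0] := eqVneq a 0; first by rewrite a0 zero_lfunE addr0; apply: Wdist.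
  have [k hk] := Kshift a Ka a0.
  have [a' [Ka' a'0 aa' a'a]] := subfieldV hK Ka a0.
  move=> Lwz.
  have le : i + 1 - k <= N0.
    apply: maxN; exists (b + a'), (z0 + a' z); split.
    - exact: subfieldD.
    - by rewrite memvD // WK.
    - apply/hk; rewrite subrK.
      have -> : y + ((b + a') w + (z0 + a' z)) = y0 + a' (w + z).
        by rewrite end_addE addrACA [y + _]addrA linearD.
      by rewrite linearD /= -end_mulE aa' end_oneE [a y0 + _]addrC -[w + z + _]addrA.
  apply: (Wdist z Wz); rewrite -[w + z](addrK (a y0)) -[w + z + _]addrA; apply: (chainB A_neq0 hL) => //.
  by apply: (chain_le hL _ (proj1 (hk _ _) Ly0)); lia.
have uniq (a : A) (z : V) (a' : A) (z' : V) : K a -> K a' -> z \in W -> z' \in W -> a w + z = a' w + z' -> a = a'.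
  move=> Ka Ka' Wz Wz' e; apply/eqP; rewrite -subr_eq0; apply/negPn/negP => /eqP d0.
  have Kd : K (a - a') by apply: subfieldB.
  have [d [Kd' _ dd d'd]] := subfieldV hK Kd d0.
  apply: (Wdist (d (z - z'))); first by rewrite WK // memvB.
  rewrite (_ : w + _ = 0); first exact: (chain0 A_neq0 hL).
  have : d ((a - a') w + (z - z')) = 0.
    by rewrite end_subE addrACA -opprD e subrr linear0.
  by rewrite linearD /= -end_mulE d'd end_oneE.
(* f y is the coefficient of w in y, along W *)
have [f hf] := choice span.
have fK (y : V) : K (f y) by have [z []] := hf y.
have fE (a : A) (z : V) : K a -> z \in W -> f (a w + z) = a.
  move=> Ka Wz; have [z' [Kf Wz' e]] := hf (a w + z).
  exact: (uniq _ _ _ _ Kf Ka Wz' Wz (esym e)).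
have fD (c : F) (y y' : V) : f (c *: y + y') = c *: f y + f y'.
  have [z [Kf Wz e]] := hf y; have [z' [Kf' Wz' e']] := hf y'.
  rewrite {1}e {1}e' (_ : c *: _ + _ = (c *: f y + f y') w + (c *: z + z')); last first.
    by rewrite scalerDr end_addE end_scaleE addrACA.
  apply: fE; last by rewrite memvD ?memvZ.
  apply: subfieldD => //; rewrite -[f y]mul1r -end_scaleAl; exact: subfieldM.
have [|x hx] := @linear_end _ V (fun y => f y u).
  by move=> c y y'; rewrite fD end_addE end_scaleE.
exists x; split.
- move=> a Ka; apply/lfunP => y; rewrite !end_mulE !hx.
  have [z [Kf Wz e]] := hf y.
  rewrite {1}e linearD /= -end_mulE fE ?end_mulE //; last exact: WK.
  exact: subfieldM.
- move=> j y Ly; rewrite hx.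
  have [-> |/eqP fy0] := eqVneq (f y) 0; first by rewrite zero_lfunE; apply: (chain0 A_neq0 hL).
  have [k hk] := Kshift _ (fK y) fy0.
  have Lfu := proj1 (hk _ _) Lu.
  apply: (chain_le hL _ Lfu); rewrite leNgt; apply/negP => lt.
  have [z [Kf Wz e]] := hf y.
  have [a' [Ka' a'0 aa' a'a]] := subfieldV hK Kf fy0.
  apply: (Wdist (a' z)); first exact: WK.
  apply/hk; rewrite linearD /= -end_mulE aa' end_oneE -e.
  by apply: (chain_le hL _ Ly); lia.
- by rewrite hx -[w in f w]addr0 -[w in f (w + _)]end_oneE fE ?end_oneE ?mem0v //; apply: subfield1.
Qed.

End ChainElements.

(** * Radicals and normalisers of the stabilizer of a chain *)

Section JacobsonRadical.
Variables (F : fieldType) (V : vectType F) (X : set 'End(V)).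
Hypothesis hX : is_subring X.
Implicit Types x y q : 'End(V).

Lemma subring1 : X 1. Proof. by case: hX. Qed.
Lemma subringB x y : X x -> X y -> X (x - y).
Proof. by case: hX => _ h Xx Xy; case: (h x y Xx Xy). Qed.
Lemma subringM x y : X x -> X y -> X (x * y).
Proof. by case: hX => _ h Xx Xy; case: (h x y Xx Xy). Qed.
Lemma subring0 : X 0.
Proof. by rewrite -(subrr 1); apply: subringB; apply: subring1. Qed.
Lemma subringN x : X x -> X (- x).
Proof. by rewrite -sub0r; apply: subringB; apply: subring0. Qed.
Lemma subringD x y : X x -> X y -> X (x + y).
Proof. by move=> Xx Xy; rewrite -[y]opprK; apply: subringB => //; apply: subringN. Qed.

Lemma radicalMl x q : X x -> jacobson_radical X q -> jacobson_radical X (x * q).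
Proof.
move=> Xx [Xq hq]; split; first exact: subringM.
by move=> I hI; have [[_ _ _ IM] _ _] := hI; apply: IM => //; apply: hq.
Qed.

Lemma left_ideal1 I : left_ideal X I -> I 1 -> I = X.
Proof.
move=> [IX _ _ IM] I1; apply/seteqP; split=> // x Xx.
by rewrite -[x]mulr1; apply: IM.
Qed.

(** Otherwise 1 - q would lie, together with q, in a maximal left ideal. *)
Lemma radical_left_unit q : jacobson_radical X q -> exists2 y, X y & y * (1 - q) = 1.
Proof.
move=> [Xq hq]; have X1q : X (1 - q) by apply: subringB => //; apply: subring1.
pose I0 : set 'End(V) := [set z | exists2 y, X y & z = y * (1 - q)].
have hI0 : left_ideal X I0.
  split.
  - by move=> _ [y Xy ->]; apply: subringM.
  - by exists 0; [exact: subring0|rewrite mul0r].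
  - move=> _ _ [y Xy ->] [z Xz ->]; exists (y + z); first exact: subringD.
    by rewrite mulrDl.
  - by move=> x _ Xx [y Xy ->]; exists (x * y); [exact: subringM|rewrite mulrA].
apply: contrapT => nI0.
have nI1 : ~ I0 1 by move=> [y Xy e]; apply: nI0; exists y.
have [F' FP [J0 FJ0] Ftot|M [[hM nM1] I0M maxM]] :=
  @Zorn_above _ (fun I => left_ideal X I /\ ~ I 1) I0 (conj hI0 nI1).
  split; last by move=> [J FJ J1]; case: (FP J FJ).
  split.
  - by move=> x [J FJ Jx]; have [[JX _ _ _] _] := FP J FJ; apply: JX.
  - by exists J0 => //; have [[]] := FP J0 FJ0.
  - move=> x y [J FJ Jx] [J' FJ' Jy].
    have [sub|sub] := Ftot _ _ FJ FJ'.
      by exists J' => //; have [[_ _ h _] _] := FP _ FJ'; apply: h => //; apply: sub.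
    by exists J => //; have [[_ _ h _] _] := FP _ FJ; apply: h => //; apply: sub.
  - by move=> x y Xx [J FJ Jy]; exists J => //; have [[_ _ _ h] _] := FP _ FJ; apply: h.
have Mmax : maximal_left_ideal X M.
  split=> //; first by move=> e; apply: nM1; rewrite e; apply: subring1.
  move=> J hJ MJ; have [J1|nJ1] := pselect (J 1); first by right; apply: left_ideal1.
  by left; apply/seteqP; split=> //; apply: maxM.
apply: nM1; rewrite -(subrK q 1); have [_ _ MD _] := hM.
apply: MD; last exact: hq.
by apply: I0M; exists 1; [exact: subring1|rewrite mul1r].
Qed.

End JacobsonRadical.

Section ChainOrders.
Variables (F : fieldType) (v : local_valuation F) (V : vectType F) (L : int -> set V).
Local Notation A := 'End(V).
Hypothesis A_neq0 : (1 : A) <> 0.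
Hypothesis hL : lattice_chain v (scalar_field V) L.
Implicit Types (x y g h : A).

Definition stabilizer : set A := [set x | forall i w, L i w -> L i (x w)].

Lemma stabilizer_subring : is_subring stabilizer.
Proof.
split; first by move=> i w; rewrite end_oneE.
move=> x y hx hy; split=> i w Lw.
  by rewrite end_subE; apply: (chainB A_neq0 hL); [exact: hx|exact: hy].
by rewrite end_mulE; apply/hx/hy.
Qed.

Lemma chain_subset_le i j : L j `<=` L i -> i <= j.
Proof.
move=> sub; rewrite leNgt; apply/negP => lt.
have [w Lw nLw] := chain_strict hL j.
by apply: nLw; apply: (chain_le hL _ (sub _ Lw)); lia.
Qed.

Lemma scalar_shifts g : scalar_field V g -> g <> 0 -> exists k, shifts_chain L g k.
Proof.
have [e _ he] := chain_scale A_neq0 hL.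
move=> [c _ <-] c0; have {}c0 : c != 0 by apply/eqP => e0; apply: c0; rewrite e0 scale0r.
have [k ek] := val_int v c0.
by exists (e * k) => i w; rewrite end_scaleE end_oneE; apply: he.
Qed.

(** An element normalising the order permutes its lattices: the image of a
   member of the chain is stable under the order, and an order acts
   transitively on the vectors of given level. *)
Lemma normaliser_permutes g h : g * h = 1 -> h * g = 1 ->
  (forall x, stabilizer x -> stabilizer (h * x * g)) ->
  forall i, exists j, forall w, L i w <-> L j (g w).
Proof.
move=> gh hg conjS i.
have gE w : h (g w) = w by rewrite -end_mulE hg end_oneE.
have [q hq] := chain_bounded A_neq0 hL g.
have [w0 Lw0 nLw0] := chain_strict hL i.
have [m nm] : exists m, ~ L m (g w0).
  apply/not_existsP => all; apply: nLw0.
  rewrite -(gE w0) (chain_separated A_neq0 hL (w := g w0)) ?linear0; first exact: (chain0 A_neq0 hL).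
  by move=> j; apply: contrapT; apply: all.
have [||j Pj maxj] := @int_max (fun j => forall w, L i w -> L j (g w)) (i + q) m.
- by move=> w; apply: hq.
- move=> j Pj; rewrite leNgt; apply/negP => mj; apply: nm.
  by apply: (chain_le hL (ltW mj)); apply: Pj.
have [w Lw nLw] : exists2 w, L i w & ~ L (j + 1) (g w).
  apply/not_exists2P => all; suff : j + 1 <= j by lia.
  by apply: maxj => w Lw; case: (all w) => // /contrapT.
exists j => z; split; first exact: Pj.
move=> Lgz.
have [x [_ Sx xw]] := chain_rank_one A_neq0 hL (scalar_subfield A_neq0)
  (fun _ Fx => Fx) scalar_shifts (Pj w Lw) nLw Lgz.
have := conjS x Sx i w Lw; by rewrite !end_mulE xw gE.
Qed.

(** The permutation of the indices induced by g is a monotone bijection of the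
    integers, that is, a translation. *)
Lemma normaliser_shifts g : order_normaliser (scalar_field V) stabilizer g ->
  exists k, shifts_chain L g k.
Proof.
move=> [_ [h [_ gh hg eS]]].
have cS x : stabilizer x -> stabilizer (h * x * g).
  rewrite -{1}eS => -[y Sy <-]; rewrite !mulrA hg mul1r -mulrA hg mulr1 //.
have cS' x : stabilizer x -> stabilizer (g * x * h) by move=> Sx; rewrite -eS; exists x.
have [sg hsg] := choice (normaliser_permutes gh hg cS).
have [th hth] := choice (normaliser_permutes hg gh cS').
have eq_idx i j : L i = L j -> i = j.
  move=> e; apply/eqP; rewrite eq_le.
  by apply/andP; split; apply: chain_subset_le; rewrite e.
have thsg i : th (sg i) = i.
  apply: eq_idx; apply/seteqP; split=> w.
    by move=> Lw; apply/(hsg i)/(hth (sg i)); rewrite -end_mulE hg end_oneE.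
  by move/(hsg i)/(hth (sg i)); rewrite -end_mulE hg end_oneE.
have sgth i : sg (th i) = i.
  apply: eq_idx; apply/seteqP; split=> w.
    by move=> Lw; apply/(hth i)/(hsg (th i)); rewrite -end_mulE gh end_oneE.
  by move/(hth i)/(hsg (th i)); rewrite -end_mulE gh end_oneE.
have mono f x y : (forall i w, L i w <-> L (f i) (x w)) -> x * y = 1 -> forall i j, i <= j -> f i <= f j.
  move=> hf xy i j ij; apply: chain_subset_le => w Lw.
  have e : w = x (y w) by rewrite -end_mulE xy end_oneE.
  by rewrite e; apply: (proj1 (hf _ _)); apply: (chain_le hL ij); apply: (proj2 (hf _ _)); rewrite -e.
have sgS i : sg (i + 1) = sg i + 1.
  have le1 : sg i <= sg (i + 1) by apply: (mono _ _ _ hsg gh); lia.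
  have ne : sg i <> sg (i + 1).
    by move=> e; have := thsg i; rewrite e thsg; lia.
  have le2 : i <= th (sg i + 1).
    by rewrite -{1}(thsg i); apply: (mono _ _ _ hth hg); lia.
  have ne2 : i <> th (sg i + 1).
    by move=> e; have := sgth (sg i + 1); rewrite -e; lia.
  have : sg (i + 1) <= sg (th (sg i + 1)) by apply: (mono _ _ _ hsg gh); lia.
  rewrite sgth; lia.
have sgE i : sg i = i + sg 0.
  case: i => n.
    elim: n => [|n IH]; first by rewrite add0r.
    by rewrite (_ : Posz n.+1 = n%:Z + 1) ?sgS ?IH; lia.
  elim: n => [|n IH].
    by have := sgS (Negz 0); rewrite (_ : Negz 0 + 1 = 0) //; lia.
  by have := sgS (Negz n.+1); rewrite (_ : Negz n.+1 + 1 = Negz n) ?IH; lia.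
by exists (sg 0) => i w; rewrite -sgE.
Qed.

(** As 1 - y is injective, the chain being separated, it is invertible, and the
    inverse z w = w + y (z w) cannot have a lower level than w. *)
Lemma chain_nilpotent_unit y : (forall i w, L i w -> L (i + 1) (y w)) ->
  exists z, [/\ stabilizer z, (1 - y) * z = 1 & z * (1 - y) = 1].
Proof.
move=> hy.
have yE w : (1 - y) w = w - y w by rewrite end_subE end_oneE.
have inj w : (1 - y) w = 0 -> w = 0.
  rewrite yE => /eqP; rewrite subr_eq0 => /eqP e.
  have [i Li] := chain_exhaust A_neq0 hL w.
  have Ln n : L (i + n%:Z) w.
    elim: n => [|n IH]; first by rewrite addr0.
    by rewrite e (_ : i + _ = i + n%:Z + 1); [exact: hy|lia].
  apply: (chain_separated A_neq0 hL) => j.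
  by apply: (chain_le hL _ (Ln `|j - i|%N)); lia.
have [z [yz zy]] := end_injective_unit inj.
exists z; split=> // i w Lw.
have zE : w = z w - y (z w) by rewrite -yE -end_mulE yz end_oneE.
have [j Lj] := chain_exhaust A_neq0 hL (z w).
have Ln n : j + n%:Z <= i -> L (j + n%:Z) (z w).
  elim: n => [|n IH] le; first by rewrite addr0.
  have -> : z w = w + y (z w) by rewrite {2}zE subrK.
  apply: (chainD A_neq0 hL); first by apply: (chain_le hL le).
  by rewrite (_ : j + _ = j + n%:Z + 1); [apply: hy; apply: IH|]; lia.
have [ij|ji] := lerP i j; first exact: (chain_le hL ij).
have := Ln `|i - j|%N; rewrite (_ : j + _ = i); last lia.
by apply.
Qed.

(** A maximal left ideal I not containing x would satisfy 1 = m + s * x with m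
    in I, whereas 1 - s * x is a unit. *)
Lemma level_raising_radical x : (forall i w, L i w -> L (i + 1) (x w)) ->
  jacobson_radical stabilizer x.
Proof.
move=> hx.
have Sx : stabilizer x by move=> i w /hx; apply: (chain_le hL); lia.
split=> // I hI; have [[IS I0 ID IM] nIS maxI] := hI; apply: contrapT => nIx.
pose J : set A := [set z | exists m s, [/\ I m, stabilizer s & z = m + s * x]].
have S0 := subring0 stabilizer_subring.
have hJ : left_ideal stabilizer J.
  split.
  - move=> _ [m [s [Im Ss ->]]]; apply: (subringD stabilizer_subring); first exact: IS.
    exact: (subringM stabilizer_subring).
  - by exists 0, 0; rewrite mul0r addr0.
  - move=> _ _ [m [s [Im Ss ->]]] [m' [s' [Im' Ss' ->]]].
    exists (m + m'), (s + s'); split; [exact: ID|exact: (subringD stabilizer_subring)|].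
    by rewrite mulrDl addrACA.
  - move=> a _ Sa [m [s [Im Ss ->]]]; exists (a * m), (a * s).
    split; [exact: IM|exact: (subringM stabilizer_subring)|].
    by rewrite mulrDr mulrA.
have IJ : I `<=` J by move=> m Im; exists m, 0; rewrite mul0r addr0.
have Jx : J x by exists 0, 1; rewrite mul1r add0r; split=> //; exact: (subring1 stabilizer_subring).
have [e|e] := maxI J hJ IJ; first by apply: nIx; rewrite -e.
have : J 1 by rewrite e; exact: (subring1 stabilizer_subring).
move=> [m [s [Im Ss e1]]].
have [|z [Sz _ zy]] := @chain_nilpotent_unit (s * x).
  by move=> i w /hx Lw; rewrite end_mulE; apply: Ss.
apply: nIS; apply: (left_ideal1 (And4 IS I0 ID IM)).
by rewrite -zy {1}e1 addrK; apply: IM.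
Qed.

(** A vector moved by q within its level would be fixed by some b * q with b in
    the order, whereas 1 - b * q is invertible. *)
Lemma radical_level_raising (K : set A) q : is_subfield K -> scalar_field V `<=` K ->
  (forall g, K g -> g <> 0 -> exists k, shifts_chain L g k) ->
  jacobson_radical (stabilizer `&` End_over K) q ->
  forall i w, L i w -> L (i + 1) (q w).
Proof.
move=> hK FK Kshift hq i w Lw; apply: contrapT => nL.
have hX : is_subring (stabilizer `&` End_over K).
  split; first by split; [exact: (subring1 stabilizer_subring)|exact: end_over1].
  move=> x y [Sx Bx] [Sy By]; split; split.
  - exact: (subringB stabilizer_subring).
  - by apply: end_overD => //; apply: end_overN.
  - exact: (subringM stabilizer_subring).
  - exact: end_overM.
have [[Sq _] _] := hq.
have [b [Bb Sb bq]] := chain_rank_one A_neq0 hL hK FK Kshift (Sq _ _ Lw) nL Lw.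
have [y _ e] := radical_left_unit hX (radicalMl hX (conj Sb Bb) hq).
apply: nL; rewrite (_ : w = 0) ?linear0; first exact: (chain0 A_neq0 hL).
have : y ((1 - b * q) w) = w by rewrite -end_mulE e end_oneE.
by rewrite end_subE end_oneE end_mulE bq subrr linear0 => <-.
Qed.

End ChainOrders.

(** * Powers of the radical of a hereditary order *)

Section ProductsOfSets.
Variables (F : fieldType) (V : vectType F).
Local Notation A := 'End(V).
Implicit Types (x y : A) (X Y Z : set A).

Lemma mulset_prod X Y x y : X x -> Y y -> mulset X Y (x * y).
Proof.
move=> Xx Yy; exists [:: (x, y)]; last by rewrite big_seq1.
by move=> p; rewrite inE => /eqP ->.
Qed.

Lemma mulset0 X Y : mulset X Y 0.
Proof. by exists [::]; rewrite ?big_nil. Qed.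

Lemma mulsetD X Y x y : mulset X Y x -> mulset X Y y -> mulset X Y (x + y).
Proof.
move=> [t ht ->] [u hu ->]; exists (t ++ u); last by rewrite big_cat.
by move=> p; rewrite mem_cat => /orP [/ht|/hu].
Qed.

Lemma mulset_sub X Y Z : Z 0 -> (forall x y, Z x -> Z y -> Z (x + y)) ->
  (forall x y, X x -> Y y -> Z (x * y)) -> mulset X Y `<=` Z.
Proof.
move=> Z0 ZD ZM _ [t ht ->]; rewrite big_seq_cond; apply: big_ind => //.
by move=> p; rewrite andbT => /ht [Xp Yp]; apply: ZM.
Qed.

Lemma ideal_pow_mono X Y I J k : X `<=` Y -> I `<=` J -> ideal_pow X I k `<=` ideal_pow Y J k.
Proof.
move=> XY IJ; elim: k => [//|k IH] /=.
apply: mulset_sub; [exact: mulset0|by move=> x y; apply: mulsetD|].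
by move=> x y /IJ Jx /IH Yy; apply: mulset_prod.
Qed.

End ProductsOfSets.

Section HereditaryOrders.
Variables (F : fieldType) (v : local_valuation F) (V : vectType F) (S : set 'End(V)).
Local Notation A := 'End(V).
Hypothesis A_neq0 : (1 : A) <> 0.
Hypothesis hS : hereditary_order v (scalar_field V) S.
Implicit Types (x y a b : A).
Local Notation P := (ideal_pow S (jacobson_radical S)).

Lemma hereditary_chain : exists2 L, lattice_chain v (scalar_field V) L & S = stabilizer L.
Proof.
have [L hL ->] := hS; exists L => //.
by apply/seteqP; split=> x; [case|split=> //; apply: end_over_scalar].
Qed.

Lemma order_subring : is_subring S.
Proof. by have [L hL ->] := hereditary_chain; apply: (stabilizer_subring A_neq0 hL). Qed.

Let S0 := subring0 order_subring.
Let SD := subringD order_subring.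
Let SM := subringM order_subring.

Lemma order_radicalE L x : lattice_chain v (scalar_field V) L -> S = stabilizer L ->
  jacobson_radical S x <-> forall i w, L i w -> L (i + 1) (x w).
Proof.
move=> hL ->; split; last exact: (level_raising_radical A_neq0 hL).
rewrite (_ : stabilizer L = stabilizer L `&` End_over (scalar_field V)); last first.
  by apply/seteqP; split=> [y|y []] //; split=> //; apply: end_over_scalar.
apply: (radical_level_raising A_neq0 hL (scalar_subfield A_neq0)) => //.
exact: (scalar_shifts A_neq0 hL).
Qed.

Lemma radical_add x y : jacobson_radical S x -> jacobson_radical S y ->
  jacobson_radical S (x + y).
Proof.
have [L hL eS] := hereditary_chain.
move=> /(order_radicalE _ hL eS) hx /(order_radicalE _ hL eS) hy.
apply/(order_radicalE _ hL eS) => i w Lw; rewrite end_addE.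
by apply: (chainD A_neq0 hL); [exact: hx|exact: hy].
Qed.

Lemma radicalMr x a : jacobson_radical S x -> S a -> jacobson_radical S (x * a).
Proof.
have [L hL eS] := hereditary_chain.
move=> /(order_radicalE _ hL eS) hx; rewrite {1}eS => Sa.
by apply/(order_radicalE _ hL eS) => i w Lw; rewrite end_mulE; apply/hx/Sa.
Qed.

Lemma radical_pow0 k : P k 0.
Proof. by case: k => [|k]; [exact: S0|exact: mulset0]. Qed.

Lemma radical_powD k x y : P k x -> P k y -> P k (x + y).
Proof. by case: k => [|k]; [exact: SD|exact: mulsetD]. Qed.

Lemma radical_powMl k a x : S a -> P k x -> P k (a * x).
Proof.
case: k => [|k] Sa; first exact: SM.
move: x; apply: mulset_sub; first by rewrite mulr0; apply: radical_pow0.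
  by move=> x y hx hy; rewrite mulrDr; apply: radical_powD.
move=> x y Jx Py; rewrite mulrA; apply: mulset_prod => //.
exact: (radicalMl order_subring).
Qed.

Lemma radical_powMr k a x : S a -> P k x -> P k (x * a).
Proof.
elim: k x => [|k IH] x Sa; first by move=> Sx; apply: SM.
move: x; apply: mulset_sub; first by rewrite mul0r; apply: (radical_pow0 k.+1).
  by move=> x y hx hy; rewrite mulrDl; apply: (radical_powD (k := k.+1)).
by move=> x y Jx Py; rewrite -mulrA; apply: mulset_prod => //; apply: IH.
Qed.

Lemma radical_powN k x : P k x -> P k (- x).
Proof. by move=> Px; rewrite -mulN1r; apply: radical_powMl => //; apply: (subringN order_subring); apply: (subring1 order_subring). Qed.

Lemma radical_powS k : P k.+1 `<=` P k.
Proof.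
apply: mulset_sub; first exact: radical_pow0.
  by move=> x y; apply: radical_powD.
by move=> x y [Sx _]; apply: radical_powMl.
Qed.

Lemma radical_pow_le k l : (k <= l)%N -> P l `<=` P k.
Proof.
move=> /subnK <-; elim: (l - k)%N => [//|n IH].
by rewrite addSn; apply: subset_trans IH; apply: radical_powS.
Qed.

Lemma radical_powSJ k : P k.+1 `<=` jacobson_radical S.
Proof.
apply: subset_trans (_ : P 1 `<=` _); first exact: radical_pow_le.
apply: mulset_sub; last by move=> x y; apply: radicalMr.
  have [L hL eS] := hereditary_chain; apply/(order_radicalE _ hL eS) => i w _.
  by rewrite zero_lfunE; apply: (chain0 A_neq0 hL).
by move=> x y; apply: radical_add.
Qed.

Lemma one_plus_radical_unit y : jacobson_radical S y ->
  exists z, [/\ S z, (1 + y) * z = 1 & z * (1 + y) = 1].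
Proof.
have [L hL eS] := hereditary_chain => /(order_radicalE _ hL eS) hy.
have [|z [Sz yz zy]] := @chain_nilpotent_unit _ v _ _ A_neq0 hL (- y).
  by move=> i w Lw; rewrite opp_lfunE; apply: (chainN A_neq0 hL); apply: hy.
by exists z; rewrite eS; rewrite opprK in yz zy.
Qed.

(** S is open: scalars of large valuation bring any operator into it. *)
Lemma order_absorbs x : exists m, forall c, vge v m c -> S (c *: x).
Proof.
have [L hL ->] := hereditary_chain.
have [e e0 he] := chain_scale A_neq0 hL.
have [q hq] := chain_bounded A_neq0 hL x.
exists `|q|%N%:Z => c hc i w Lw; rewrite end_scaleE.
have [->|c0] := eqVneq c 0; first by rewrite scale0r; apply: (chain0 A_neq0 hL).
have [k ek] := val_int v c0; move: hc; rewrite /vge ek lee_fin => hc.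
have := proj1 (he _ _ ek _ _) (hq _ _ Lw); apply: (chain_le hL).
have : `|q|%N%:Z <= e * k by rewrite -[X in X <= _]mul1r; apply: ler_pM => //; lia.
lia.
Qed.

Lemma radical_pow_scale p k x : v p = 1%:E -> S x -> P k (p ^+ k *: x).
Proof.
move=> ep Sx; elim: k => [|k IH]; first by rewrite expr0 scale1r.
rewrite exprS -scalerA -[X in _ *: X]mul1r -end_scaleAl; apply: mulset_prod => //.
have [L hL eS] := hereditary_chain; have [e e0 he] := chain_scale A_neq0 hL.
apply/(order_radicalE _ hL eS) => i w Lw; rewrite end_scaleE end_oneE.
by apply: (chain_le hL _ (proj1 (he _ _ ep _ _) Lw)); lia.
Qed.

Lemma radical_pow_nbhd k : is_nbhd v (P k).
Proof.
have [p p0 ep] := uniformizer v.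
have [f hf] := choice (fun i : 'I_(\dim {:A}) => order_absorbs (vbasis {:A})`_i).
exists ((\sum_i `|f i|)%N%:Z + k%:Z) => x hx.
rewrite (coordE x); apply: big_ind => [| |i _]; first exact: radical_pow0.
  by move=> ? ?; apply: radical_powD.
have pk : p ^+ k != 0 by rewrite expf_neq0.
rewrite -[coord _ _ _](mulfVK pk) mulrC -scalerA; apply: radical_pow_scale => //.
apply: hf; apply: (@vgeW _ v ((\sum_i `|f i|)%N%:Z + k%:Z + - k%:Z)).
  by rewrite (bigD1 i) //=; lia.
apply: vgeM; first exact: hx.
rewrite -exprVn -[k%:Z]mul1r -mulNr; apply: vgeX.
by rewrite /vge (valV p0 ep).
Qed.

Lemma neg_radical_pow_le (k l : int) : k <= l ->
  radical_pow (scalar_field V) S l `<=` radical_pow (scalar_field V) S k.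
Proof.
have negz m : radical_pow (scalar_field V) S (- m%:Z) =
    [set x | forall y, P m y -> S (x * y)].
  case: m => [|m]; apply/seteqP; split=> x.
  - by move=> Sx y Sy; apply: SM.
  - by move=> h; rewrite -[x]mulr1; apply: h; apply: (subring1 order_subring).
  - by case.
  - by move=> h; split=> //; apply: end_over_scalar.
case: l => l; case: k => k kl x.
- exact: radical_pow_le.
- rewrite (_ : Negz k = - k.+1%:Z) // negz => Px y Py.
  by apply: SM; [exact: (radical_pow_le (leq0n l))|exact: (radical_pow_le (leq0n k.+1))].
- by [].
- rewrite (_ : Negz k = - k.+1%:Z) // (_ : Negz l = - l.+1%:Z) // !negz => hx y Py.
  by apply: hx; apply: (radical_pow_le _ Py); lia.
Qed.

(** The radical of the centraliser order lies in the radical of S, since both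
    act on the same lattices.  So if c were in P^(1 - r), it would be in the same
    power of the radical of the centraliser order: a negative power is defined
    by what multiplication does to a positive one, and gets larger when the
    radical gets smaller. *)
Lemma nu_centraliser (E : set A) (c : A) (r : int) : is_subfield E -> scalar_field V `<=` E ->
  units_of E `<=` order_normaliser (scalar_field V) S ->
  0 < r -> End_over E c -> radical_pow (scalar_field V) S (- r) c ->
  nu E (S `&` End_over E) c = (- r)%:E -> nu (scalar_field V) S c = (- r)%:E.
Proof.
move=> hE FE normE r0 Bc Pc; rewrite /nu; case: eqP => // /eqP c0 [e].
have [L hL eS] := hereditary_chain.
set Q := [set k | radical_pow E (S `&` End_over E) k c] in e.
(* the default value 0 of xget differs from - r, so that the maximum exists *)
have Qmax : is_max Q (- r).
  rewrite -e; have [h|] := pselect (exists k, is_max Q k).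
    by case: h => k hk; apply: (xgetPex 0); exists k.
  move=> nh; exfalso; move: e; rewrite xgetPN; last by move=> k hk; apply: nh; exists k.
  lia.
have maxr l : radical_pow (scalar_field V) S l c -> l <= - r.
  move=> Pl; rewrite leNgt; apply/negP => lt.
  have {}Pl : radical_pow (scalar_field V) S (- (`|r - 1|%N)%:Z) c.
    by apply: neg_radical_pow_le Pl; lia.
  have sub k : ideal_pow (S `&` End_over E) (jacobson_radical (S `&` End_over E)) k `<=` P k.
    apply: ideal_pow_mono; first by move=> x [].
    move=> x Jx; apply/(order_radicalE _ hL eS).
    rewrite eS in Jx; apply: (radical_level_raising A_neq0 hL hE FE _ Jx).
    move=> g Eg g0; apply: (normaliser_shifts A_neq0 hL).
    by rewrite -eS; apply: normE; apply: (subfield_units hE).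
  have subB k : ideal_pow (S `&` End_over E) (jacobson_radical (S `&` End_over E)) k `<=` End_over E.
    elim: k => [|k IH]; first by move=> x [].
    apply: mulset_sub; first by move=> a _; rewrite mul0r mulr0.
      by move=> x y; apply: end_overD.
    by move=> x y [[_ Bx] _] /IH By; apply: end_overM.
  suff : Q (- (`|r - 1|%N)%:Z) by move/(proj2 Qmax); lia.
  move: Pl; rewrite /Q; case: `|_|%N => [|m] /=; first by split.
  move=> [_ h]; split=> // y hy; split; first by apply: h; apply: (sub m.+1).
  by apply: end_overM => //; apply: (subB m.+1).
congr _%:E; apply: xget_unique; first by split.
by move=> k [Pk maxk]; apply/eqP; rewrite eq_le maxr //= maxk.
Qed.

End HereditaryOrders.

(** * Determinants over a subfield of End(V) *)

Section SubfieldType.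
Variables (F : fieldType) (V : vectType F) (K : set 'End(V)).
Hypothesis hK : is_subfield K.
Local Notation A := 'End(V).

(** The argument, a proof that K is a subfield, is what the field structure of
    the type is built from. *)
Definition sfield & is_subfield K := {x : A | `[< K x >]}.
Local Notation KT := (sfield hK).

HB.instance Definition _ := Choice.copy KT {x : A | `[< K x >]}.

Definition sfield_val (a : KT) : A := sval a.
Definition to_sfield x (Kx : K x) : KT := exist _ x (introT (asboolP _) Kx).

Lemma sfield_valP (a : KT) : K (sfield_val a).
Proof. by case: a => x /= /asboolP. Qed.

Lemma sfield_val_inj : injective sfield_val.
Proof. by move=> a b; apply: val_inj. Qed.

Let zero := to_sfield (subfield0 hK).
Let one := to_sfield (subfield1 hK).
Let add a b := to_sfield (subfieldD hK (sfield_valP a) (sfield_valP b)).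
Let opp a := to_sfield (subfieldN hK (sfield_valP a)).
Let mul a b := to_sfield (subfieldM hK (sfield_valP a) (sfield_valP b)).

Fact sfield_addA : associative add.
Proof. by move=> a b c; apply: sfield_val_inj; apply: addrA. Qed.
Fact sfield_addC : commutative add.
Proof. by move=> a b; apply: sfield_val_inj; apply: addrC. Qed.
Fact sfield_add0 : left_id zero add.
Proof. by move=> a; apply: sfield_val_inj; apply: add0r. Qed.
Fact sfield_addN : left_inverse zero opp add.
Proof. by move=> a; apply: sfield_val_inj; apply: addNr. Qed.

HB.instance Definition _ := GRing.isZmodule.Build KT
  sfield_addA sfield_addC sfield_add0 sfield_addN.

Fact sfield_mulA : associative mul.
Proof. by move=> a b c; apply: sfield_val_inj; apply: mulrA. Qed.
Fact sfield_mulC : commutative mul.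
Proof. by move=> a b; apply: sfield_val_inj; apply: (subfieldC hK); apply: sfield_valP. Qed.
Fact sfield_mul1 : left_id one mul.
Proof. by move=> a; apply: sfield_val_inj; apply: mul1r. Qed.
Fact sfield_mulD : left_distributive mul +%R.
Proof. by move=> a b c; apply: sfield_val_inj; apply: mulrDl. Qed.
Fact sfield_one_neq0 : one != 0.
Proof. by apply/eqP => /(congr1 sfield_val); apply: (subfield_neq0 hK). Qed.

HB.instance Definition _ := GRing.Zmodule_isComNzRing.Build KT
  sfield_mulA sfield_mulC sfield_mul1 sfield_mulD sfield_one_neq0.

Fact sfield_inv_ex (a : KT) : exists b : KT, (a != 0 -> b * a = 1) /\ (a = 0 -> b = 0).
Proof.
have [->|a0] := eqVneq a 0; first by exists 0.
have [|y [Ky _ _ yx]] := subfieldV hK (sfield_valP a).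
  by move=> e; move/eqP: a0; apply; apply: sfield_val_inj.
exists (to_sfield Ky); split; last by move=> e; rewrite e eqxx in a0.
by move=> _; apply: sfield_val_inj.
Qed.

Let inv a := sval (cid (sfield_inv_ex a)).

Fact sfield_mulV (a : KT) : a != 0 -> inv a * a = 1.
Proof. by rewrite /inv; case: cid => b /= []. Qed.
Fact sfield_inv0 : inv 0 = 0.
Proof. by rewrite /inv; case: cid => b /= [_]; apply. Qed.

HB.instance Definition _ := GRing.ComNzRing_isField.Build KT sfield_mulV sfield_inv0.

Fact sfield_val_zmod : zmod_morphism sfield_val.
Proof. by []. Qed.
Fact sfield_val_monoid : monoid_morphism sfield_val.
Proof. by []. Qed.

HB.instance Definition _ := GRing.isZmodMorphism.Build KT A sfield_val sfield_val_zmod.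
HB.instance Definition _ := GRing.isMonoidMorphism.Build KT A sfield_val sfield_val_monoid.

End SubfieldType.

Section Bases.
Variables (F : fieldType) (V : vectType F) (K : set 'End(V)).
Hypothesis hK : is_subfield K.
Hypothesis FK : scalar_field V `<=` K.
Local Notation A := 'End(V).
Local Notation KT := (sfield hK).
Local Notation val := (@sfield_val F V K hK).
Implicit Types (x y : A).

Lemma scale_end (c : F) (w : V) : c *: w = (c *: (1 : A)) w.
Proof. by rewrite end_scaleE end_oneE. Qed.

(** A generating family of minimal length is a basis. *)
Lemma basis_over_exists : exists m (e : 'I_m.+1 -> V), is_basis_over K e.
Proof.
pose gen m (e : 'I_m -> V) := forall w : V,
  exists2 a : 'I_m -> A, (forall i, K (a i)) & w = \sum_i a i (e i).
pose P m := `[< exists e : 'I_m -> V, gen m e >].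
have exP : exists m, P m.
  exists (\dim {:V}); apply/asboolP; exists (fun i => (vbasis {:V})`_i) => w.
  exists (fun i => coord (vbasis {:V}) i w *: (1 : A)).
    by move=> i; apply: FK; eexists.
  rewrite {1}(coord_vbasis (memvf w)); apply: eq_bigr => i _.
  exact: scale_end.
have [m /asboolP [e he] minm] := ex_minnP exP.
have free (a : 'I_m -> A) : (forall i, K (a i)) -> \sum_i a i (e i) = 0 -> forall i, a i = 0.
  move=> Ka sa k; apply/eqP; apply/negPn/negP => /eqP ak.
  case: m e he minm a Ka sa k ak => [|m] e he minm a Ka sa k ak; first by case: k ak.
  have [b [Kb _ ab ba]] := subfieldV hK (Ka k) ak.
  suff /minm : P m by rewrite ltnn.
  apply/asboolP; exists (fun i => e (lift k i)) => w.
  have [c Kc ew] := he w.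
  exists (fun i => c (lift k i) - c k * b * a (lift k i)).
    move=> i; apply: (subfieldB hK); first exact: Kc.
    by apply: (subfieldM hK); [apply: (subfieldM hK)|].
  transitivity (\sum_i (c i - c k * b * a i) (e i)).
    have e0 : \sum_i (c k * b * a i) (e i) = 0.
      transitivity ((c k * b) (\sum_i a i (e i))); last by rewrite sa linear0.
      rewrite linear_sum.
      by apply: eq_bigr => i _; rewrite /= !end_mulE.
    under eq_bigr => i _ do rewrite end_subE.
    by rewrite sumrB e0 subr0.
  by rewrite (bigD1_ord k) //= -mulrA ba mulr1 subrr zero_lfunE add0r.
case: m e he minm free => [|m] e he minm free; last by exists m, e.
case: (subfield_neq0 hK); apply/lfunP => w; have [a _ ->] := he w.
by rewrite !big_ord0 !linear0.
Qed.

Section OneBasis.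
Variables (m : nat) (e : 'I_m -> V).
Hypothesis he : is_basis_over K e.

Definition represents (x : A) (M : 'M[KT]_m) : Prop :=
  forall j, x (e j) = \sum_i val (M i j) (e i).

Lemma basis_coord w : exists a : 'I_m -> KT, w = \sum_i val (a i) (e i).
Proof.
have [gen _] := he; have [a Ka ->] := gen w.
by exists (fun i => to_sfield hK (Ka i)).
Qed.

Lemma basis_coord_inj (a b : 'I_m -> KT) :
  \sum_i val (a i) (e i) = \sum_i val (b i) (e i) -> a =1 b.
Proof.
move=> eab i; apply/eqP; rewrite -subr_eq0; apply/eqP; apply: sfield_val_inj.
rewrite rmorph0; have [_ free] := he; apply: (free (fun i => val (a i - b i))).
  by move=> j; apply: sfield_valP.
under eq_bigr => j _ do rewrite rmorphB /= end_subE.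
by rewrite sumrB eab subrr.
Qed.

Lemma represents_exists x : exists M, represents x M.
Proof.
have [f hf] := choice (fun j => basis_coord (x (e j))).
by exists (\matrix_(i, j) f j i) => j; rewrite hf; apply: eq_bigr => i _; rewrite mxE.
Qed.

Lemma represents_inj x y M : End_over K x -> End_over K y ->
  represents x M -> represents y M -> x = y.
Proof.
move=> Bx By hx hy; apply/lfunP => w; have [a ->] := basis_coord w.
rewrite !linear_sum; apply: eq_bigr => i _.
by rewrite /= -!end_mulE Bx ?By ?end_mulE ?hx ?hy //; apply: sfield_valP.
Qed.

Lemma representsM x y M N : End_over K x -> represents x M -> represents y N ->
  represents (x * y) (M *m N).
Proof.
move=> Bx hM hN j; rewrite end_mulE hN linear_sum.
transitivity (\sum_k \sum_i val (N k j * M i k) (e i)).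
  apply: eq_bigr => k _.
  rewrite /= -end_mulE Bx; last exact: sfield_valP.
  rewrite end_mulE hM linear_sum; apply: eq_bigr => i _.
  by rewrite /= -end_mulE -rmorphM.
rewrite exchange_big; apply: eq_bigr => i _; rewrite mxE rmorph_sum end_sumE.
by apply: eq_bigr => k _; rewrite mulrC.
Qed.

Lemma representsD x y M N : represents x M -> represents y N -> represents (x + y) (M + N).
Proof.
move=> hM hN j; rewrite end_addE hM hN -big_split; apply: eq_bigr => i _.
by rewrite mxE rmorphD /= end_addE.
Qed.

Lemma represents1 : represents 1 1%:M.
Proof.
move=> j; rewrite end_oneE (bigD1 j) //= big1 ?addr0 => [|i ij].
  by rewrite mxE eqxx rmorph1 end_oneE.
by rewrite mxE (negPf ij) rmorph0 zero_lfunE.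
Qed.

Lemma represents_scale (a : KT) x M : represents x M -> represents (val a * x) (a *: M).
Proof.
move=> hM j; rewrite end_mulE hM linear_sum; apply: eq_bigr => i _.
by rewrite mxE rmorphM /= end_mulE.
Qed.

Lemma end_of_matrix M : exists2 x, End_over K x & represents x M.
Proof.
have [f hf] := choice basis_coord.
have fE (a : 'I_m -> KT) i : f (\sum_i val (a i) (e i)) i = a i.
  by apply: basis_coord_inj; rewrite -hf.
have fD (b : KT) u w i : f (val b u + w) i = b * f u i + f w i.
  rewrite -(fE (fun i => b * f u i + f w i)); congr (f _ i).
  rewrite {1}(hf u) {1}(hf w) linear_sum -big_split; apply: eq_bigr => k _.
  by rewrite rmorphD rmorphM /= end_addE end_mulE.
have [|x hx] := @linear_end _ V (fun w => \sum_j \sum_i val (f w j * M i j) (e i)).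
  move=> c u w; have Kc : K (c *: (1 : A)) by apply: FK; exists c.
  have -> : c *: u + w = val (to_sfield hK Kc) u + w by rewrite scale_end.
  rewrite scaler_sumr -big_split; apply: eq_bigr => j _ /=.
  rewrite scaler_sumr -big_split; apply: eq_bigr => i _ /=.
  have := fD (to_sfield hK Kc) u w j => /= ->.
  by rewrite rmorphD rmorphM /= mulrDl end_addE -mulrA end_mulE scale_end.
exists x.
  move=> a Ka; apply/lfunP => w; rewrite !end_mulE !hx.
  rewrite linear_sum; apply: eq_bigr => j _; rewrite linear_sum; apply: eq_bigr => i _.
  have := fD (to_sfield hK Ka) w 0 j; rewrite addr0 => ->.
  rewrite (_ : f 0 j = 0) ?addr0; first by rewrite -mulrA rmorphM /= end_mulE.
  rewrite -[RHS](fE (fun _ => 0) j); congr (f _ j).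
  by rewrite big1 // => k _; rewrite rmorph0 zero_lfunE.
move=> j; rewrite hx.
have fe k : f (e j) k = (j == k)%:R.
  rewrite -(fE (fun k => (j == k)%:R)); congr (f _ k).
  rewrite (bigD1 j) //= eqxx rmorph1 end_oneE big1 ?addr0 // => i /negPf ij.
  by rewrite eq_sym ij rmorph0 zero_lfunE.
rewrite (bigD1 j) //= [X in _ + X]big1 ?addr0.
  by apply: eq_bigr => i _; rewrite fe eqxx mul1r.
move=> k /negPf kj; rewrite big1 // => i _.
by rewrite fe eq_sym kj mul0r ?rmorph0 zero_lfunE.
Qed.

End OneBasis.

(** Two bases have the same length and give conjugate matrices. *)
Lemma det_basis_independent m (e : 'I_m -> V) m' (e' : 'I_m' -> V) x M M' :
  is_basis_over K e -> is_basis_over K e' -> End_over K x ->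
  represents e x M -> represents e' x M' -> \det M = \det M'.
Proof.
move=> he he' Bx hM hM'.
have change p (b : 'I_p -> V) p' (b' : 'I_p' -> V) : is_basis_over K b ->
    exists P : 'M[KT]_(p, p'), forall j, b' j = \sum_i val (P i j) (b i).
  move=> hb; have [f hf] := choice (fun j => basis_coord hb (b' j)).
  by exists (\matrix_(i, j) f j i) => j; rewrite {1}hf; apply: eq_bigr => i _; rewrite mxE.
have comp p q (b : 'I_p -> V) (P : 'M[KT]_(p, q)) (a : 'I_q -> KT) :
    \sum_j val (a j) (\sum_i val (P i j) (b i)) = \sum_i val (\sum_j P i j * a j) (b i).
  transitivity (\sum_j \sum_i val (a j * P i j) (b i)).
    apply: eq_bigr => j _; rewrite linear_sum; apply: eq_bigr => i _.
    by rewrite rmorphM /= end_mulE.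
  rewrite exchange_big; apply: eq_bigr => i _; rewrite rmorph_sum end_sumE.
  by apply: eq_bigr => j _; rewrite mulrC.
have [P hP] := change _ _ _ e' he; have [Q hQ] := change _ _ _ e he'.
have inv p (b : 'I_p -> V) p' (b' : 'I_p' -> V) (P1 : 'M[KT]_(p, p')) (Q1 : 'M[KT]_(p', p)) :
    is_basis_over K b -> (forall j, b' j = \sum_i val (P1 i j) (b i)) ->
    (forall j, b j = \sum_i val (Q1 i j) (b' i)) -> P1 *m Q1 = 1%:M.
  move=> hb h1 h2; apply/matrixP => i j.
  apply: (basis_coord_inj hb (a := (P1 *m Q1)^~ j) (b := 1%:M^~ j)).
  rewrite -(represents1 b) end_oneE [RHS]h2.
  under [RHS]eq_bigr => k _ do rewrite h1.
  by rewrite comp; apply: eq_bigr => k _; rewrite mxE.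
have PQ := inv _ _ _ _ _ _ he hP hQ; have QP := inv _ _ _ _ _ _ he' hQ hP.
have em : m = m' by apply/eqP; rewrite eqn_leq (mulmx1_min PQ) (mulmx1_min QP).
subst m'.
have MP : M *m P = P *m M'.
  apply/matrixP => i j; apply: (basis_coord_inj he (a := (M *m P)^~ j) (b := (P *m M')^~ j)).
  transitivity (x (e' j)); last first.
    rewrite hM'; under eq_bigr => k _ do rewrite hP.
    by rewrite comp; apply: eq_bigr => k _; rewrite mxE.
  rewrite hP linear_sum.
  transitivity (\sum_k val (P k j) (\sum_i val (M i k) (e i))).
    by rewrite comp; apply: eq_bigr => k _; rewrite mxE.
  by apply: eq_bigr => k _; rewrite -hM /= -!end_mulE Bx //; apply: sfield_valP.
have dP : \det P * \det Q = 1 by rewrite -det_mulmx PQ det1.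
have : \det M * \det P = \det M' * \det P by rewrite -det_mulmx MP det_mulmx mulrC.
move/(congr1 ( *%R^~ (\det Q))); by rewrite /= -!mulrA dP !mulr1.
Qed.

Lemma det_overE m (e : 'I_m -> V) x M : is_basis_over K e -> End_over K x ->
  represents e x M -> det_over K x = val (\det M).
Proof.
move=> he Bx hM; rewrite -det_map_mx; apply: xget_unique.
  exists m, e, (map_mx val M); split=> //.
    by move=> i j; rewrite mxE; apply: sfield_valP.
  by move=> j; rewrite hM; apply: eq_bigr => i _; rewrite mxE.
move=> _ [m' [e' [N [he' KN hN ->]]]].
pose N' : 'M[KT]_m' := \matrix_(i, j) to_sfield hK (KN i j).
have eN : N = map_mx val N' by apply/matrixP => i j; rewrite !mxE.
rewrite eN !det_map_mx; congr (val _).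
apply: (det_basis_independent he' he Bx _ hM) => j.
by rewrite hN; apply: eq_bigr => i _; rewrite !mxE.
Qed.

End Bases.

Section Determinants.
Variables (F : fieldType) (v : local_valuation F) (V : vectType F) (K : set 'End(V)).
Hypothesis hK : is_subfield K.
Hypothesis FK : scalar_field V `<=` K.
Local Notation A := 'End(V).
Local Notation KT := (sfield hK).
Local Notation val := (@sfield_val F V K hK).
Implicit Types (x y : A).

Lemma units_end_overP x y : End_over K x -> x * y = 1 -> units_of (End_over K) x.
Proof.
move=> Bx xy; split=> //; exists y; first exact: (end_overV Bx xy).
by split=> //; apply: end_mul1C.
Qed.

Lemma det_overM x y : End_over K x -> End_over K y ->
  det_over K (x * y) = det_over K x * det_over K y.
Proof.
move=> Bx By; have [m [e he]] := basis_over_exists hK FK.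
have [M hM] := represents_exists hK he x; have [N hN] := represents_exists hK he y.
rewrite (det_overE he (end_overM Bx By) (representsM Bx hM hN)).
by rewrite (det_overE he Bx hM) (det_overE he By hN) det_mulmx rmorphM.
Qed.

Lemma det_over1 : det_over K 1 = 1.
Proof.
have [m [e he]] := basis_over_exists hK FK.
by rewrite (det_overE he (@end_over1 _ _ K) (represents1 hK e)) det1 rmorph1.
Qed.

Lemma det_over_field x : End_over K x -> K (det_over K x).
Proof.
move=> Bx; have [m [e he]] := basis_over_exists hK FK.
have [M hM] := represents_exists hK he x.
by rewrite (det_overE he Bx hM); apply: sfield_valP.
Qed.

Lemma det_over_neq0 x : units_of (End_over K) x -> det_over K x <> 0.
Proof.
move=> [Bx [y By [xy _]]] d0; apply: (subfield_neq0 hK).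
by rewrite -det_over1 -xy det_overM // d0 mul0r.
Qed.

(** With p the projection onto the first vector of a basis, 1 + (d - 1) * p has
    matrix diag(d, 1, ..., 1). *)
Lemma det_section : exists2 p, End_over K p &
  forall d, K d -> End_over K (1 + (d - 1) * p) /\ det_over K (1 + (d - 1) * p) = d.
Proof.
have [m [e he]] := basis_over_exists hK FK.
have [p Bp hp] := end_of_matrix FK he (delta_mx ord0 ord0).
exists p => // d Kd.
have Kd1 : K (d - 1) by apply: (subfieldB hK) => //; apply: (subfield1 hK).
have B1 : End_over K (1 + (d - 1) * p).
  apply: end_overD; first exact: end_over1.
  by apply: end_overM => // a Ka; apply: (subfieldC hK).
split=> //.
have := representsD (represents1 hK e) (represents_scale (to_sfield hK Kd1) hp).
move=> /(det_overE he B1) ->.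
set M := _ + _.
have -> : M = diag_mx (\row_j (if j == ord0 then to_sfield hK Kd else 1)).
  apply/matrixP => i j; rewrite !mxE.
  have ed : to_sfield hK Kd1 = to_sfield hK Kd - 1 by apply: sfield_val_inj.
  have [->|ij] := eqVneq i j; last first.
    rewrite mulr0n add0r; case: eqP => [i0|_]; last by rewrite mulr0.
    case: eqP => [j0|_]; last by rewrite mulr0.
    by rewrite i0 j0 eqxx in ij.
  rewrite mulr1n andbb; case: ifP => _; last by rewrite mulr0 addr0.
  by rewrite mulr1 ed addrC subrK.
rewrite det_diag big_ord_recl mxE eqxx big1 ?mulr1 // => i _.
by rewrite mxE -(inj_eq val_inj).
Qed.

(** The quotient of x by y has determinant 1, and a uniformizer of F is an element
    of K other than 0 and 1, as [char_det1] requires. *)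
Theorem char_factors_det (C : fieldType) (chi : A -> C) :
  (forall x y, units_of (End_over K) x -> units_of (End_over K) y ->
     chi (x * y) = chi x * chi y) ->
  (forall x, units_of (End_over K) x -> chi x != 0) ->
  forall x y, units_of (End_over K) x -> units_of (End_over K) y ->
    det_over K x = det_over K y -> chi x = chi y.
Proof.
move=> chiM chi0.
have [m [e he]] := basis_over_exists hK FK.
have [f hf] := choice (fun M => let: ex_intro2 x Bx hx := end_of_matrix FK he M in
  ex_intro (fun x => End_over K x /\ represents e x M) x (conj Bx hx)).
have fB M : End_over K (f M) by case: (hf M).
have fR M : represents e (f M) M by case: (hf M).
have fM M N : f (M *m N) = f M * f N.
  apply: (represents_inj he (fB _) _ (fR _)); first exact: end_overM.
  exact: representsM.
have f1 : f 1%:M = 1.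
  by apply: (represents_inj he (fB _) _ (fR _)); [exact: end_over1|exact: represents1].
have fU M : M \in unitmx -> units_of (End_over K) (f M).
  move=> uM; apply: (units_end_overP (y := f (invmx M))) => //.
  by rewrite -fM mulmxV.
have [p p0 ep] := uniformizer v.
have KZ (c : F) : K (c *: (1 : A)) by apply: FK; exists c.
have A0 := subfield_neq0 hK.
have t0 : to_sfield hK (KZ p) != 0.
  apply/eqP => /(congr1 val) /= e0; move/eqP: p0; apply; apply: (scalar_inj A0).
  by rewrite scale0r.
have t1 : to_sfield hK (KZ p) != 1.
  apply/eqP => /(congr1 val) /= e0.
  have p1 : p = 1 by apply: (scalar_inj A0); rewrite scale1r.
  by have := val1 v; rewrite -p1 ep.
have key z : units_of (End_over K) z -> det_over K z = 1 -> chi z = 1.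
  move=> [Bz _] dz; have [M hM] := represents_exists hK he z.
  have -> : z = f M by apply: (represents_inj he Bz (fB _) hM).
  apply: (char_det1 t0 t1 (chi := chi \o f)); last first.
    by apply: sfield_val_inj; rewrite -(det_overE he Bz hM).
  split=> [M' N' uM uN|M' uM].
    have e1 := fM M' N'.
    have e2 := chiM _ _ (fU _ uM) (fU _ uN).
    rewrite -e1 in e2.
    exact: e2.
  exact: (chi0 _ (fU _ uM)).
move=> x y [Bx ux] [By [y' By' [yy' y'y]]] dxy.
have uy : units_of (End_over K) y by split=> //; exists y'.
have uy' : units_of (End_over K) y' by split=> //; exists y.
have uxy' : units_of (End_over K) (x * y').
  have [x' Bx' [xx' x'x]] := ux.
  apply: (units_end_overP (y := y * x')); first exact: end_overM.
  by rewrite mulrA -[x * y' * y]mulrA y'y mulr1 xx'.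
rewrite -[x]mulr1 -y'y mulrA chiM // key ?mul1r //.
by rewrite det_overM // dxy -det_overM // yy' det_over1.
Qed.

End Determinants.

(** * Factorisation of characters along a filtration *)

Section CharactersThroughDet.
Variables (F : fieldType) (v : local_valuation F) (V : vectType F) (R : realType).
Variable (K : set 'End(V)).
Hypothesis hK : is_subfield K.
Hypothesis FK : scalar_field V `<=` K.
Local Notation A := 'End(V).
Local Notation C := R[i].

(** The character chi descends to the group of determinants of G and extends from
    there to K^*.  The extension phi is trivial near 1: for d close to 1 the
    element 1 + (d - 1) * p of determinant d is in G and close to 1, so that
    phi d is the value of chi at this element, which is 1. *)
Theorem smooth_char_through_det (G : set A) (chi : A -> C) :
  G `<=` End_over K -> G 1 ->
  (forall x y, G x -> G y -> G (x * y)) ->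
  (forall x, G x -> exists2 y, G y & x * y = 1) ->
  (forall x y, G x -> G y -> chi (x * y) = chi x * chi y) ->
  (forall x, G x -> chi x != 0) ->
  (forall x y, G x -> G y -> det_over K x = det_over K y -> chi x = chi y) ->
  (exists2 U, is_nbhd v U & forall y, U y -> End_over K (1 + y) -> G (1 + y) /\ chi (1 + y) = 1) ->
  exists2 phi, smooth_char v (units_of K) phi & forall x, G x -> chi x = phi (det_over K x).
Proof.
move=> GB G1 GM GV chiM chi0 chidet [U Unbhd hU].
pose val := @sfield_val _ _ K hK.
pose Gd : set (sfield hK) := [set a | exists2 x, G x & det_over K x = val a].
have GU x : G x -> units_of (End_over K) x.
  by move=> Gx; have [y Gy xy] := GV x Gx; apply: (units_end_overP (y := y)) => //; apply: GB.
have total a : exists c : C, forall x, G x -> det_over K x = val a -> chi x = c.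
  have [[x Gx dx]|n] := pselect (exists2 x, G x & det_over K x = val a).
    by exists (chi x) => y Gy dy; apply: chidet => //; rewrite dy.
  by exists 0 => x Gx dx; case: n; exists x.
have [eta heta] := choice total.
have etaE a x : G x -> det_over K x = val a -> eta a = chi x.
  by move=> Gx dx; rewrite (heta a x).
have dM x y : G x -> G y -> det_over K (x * y) = det_over K x * det_over K y.
  by move=> Gx Gy; apply: det_overM => //; apply: GB.
have [|||||phi [phiM phi0 phiE]] := @extend_character _ C Gd eta.
- by exists 1 => //; rewrite (det_over1 hK FK).
- move=> a b [x Gx dx] [y Gy dy]; exists (x * y); first exact: GM.
  by rewrite dM // dx dy /val rmorphM.
- move=> a [x Gx dx]; have a0 : a != 0.
    apply/eqP => a0; apply: (det_over_neq0 hK FK (GU _ Gx)).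
    by rewrite dx a0 /val rmorph0.
  split=> //; have [y Gy xy] := GV x Gx; exists y => //.
  have := dM _ _ Gx Gy; rewrite xy (det_over1 hK FK) dx => e.
  have Ky : K (det_over K y) by apply: (det_over_field hK FK); apply: GB.
  rewrite -[LHS]/(val (to_sfield hK Ky)); congr (val _).
  apply: (mulfI a0); rewrite divff //; apply: sfield_val_inj.
  by rewrite rmorphM rmorph1 /= [RHS]e.
- move=> a b [x Gx dx] [y Gy dy].
  rewrite (etaE a x) // (etaE b y) // (etaE _ (x * y)) ?chiM //; first exact: GM.
  by rewrite dM // dx dy /val rmorphM.
- by move=> a [x Gx dx]; rewrite (etaE a x) // chi0.
pose phiK (x : A) : C := if pselect (K x) is left Kx then phi (to_sfield hK Kx) else 0.
have phiKE a : phiK (val a) = phi a.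
  rewrite /phiK; case: pselect => [Kx|nK]; last by case: nK; apply: sfield_valP.
  by congr phi; apply: sfield_val_inj.
have unitE x : units_of K x -> exists2 a, a != 0 & x = val a.
  move=> [Kx [y _ [xy _]]]; exists (to_sfield hK Kx) => //.
  apply/eqP => /(congr1 val) e; apply: (subfield_neq0 hK).
  by rewrite -xy [x]e /val rmorph0 mul0r.
have phiKdet x : G x -> chi x = phiK (det_over K x).
  move=> Gx; have Kd : K (det_over K x) by apply: (det_over_field hK FK); apply: GB.
  rewrite -[det_over K x]/(val (to_sfield hK Kd)) phiKE phiE; last by exists x.
  by rewrite (etaE _ x).
exists phiK => //; split.
- move=> x y /unitE [a a0 ->] /unitE [b b0 ->].
  by rewrite -[_ * _]/(val (a * b)) !phiKE phiM.
- by move=> x /unitE [a a0 ->]; rewrite phiKE; apply/eqP/phi0.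
- have [p Bp hp] := det_section hK FK.
  have [L latL LU] := nbhd_lattice (subfield_neq0 hK) (nbhd_mulr p Unbhd).
  exists L => // d [Kd _] /LU Ud.
  have [Bd dd] := hp d Kd; have [Gd' chid] := hU _ Ud Bd.
  by rewrite -[d in LHS]dd -phiKdet.
Qed.

End CharactersThroughDet.

Section Factorisation.
Variables (F : fieldType) (v : local_valuation F) (V : vectType F) (R : realType).
Local Notation A := 'End(V).
Local Notation C := R[i].
Variables (s : nat) (E G : nat -> set A) (theta psi : nat -> A -> C).
Local Notation B i := (End_over (E i)).
Hypothesis hE : forall i, (i <= s)%N -> is_subfield (E i) /\ scalar_field V `<=` E i.
Hypothesis EE : forall i, (i < s)%N -> E i.+1 `<=` E i.
Hypothesis G1 : forall i, (i <= s.+1)%N -> G i 1.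
Hypothesis GM : forall i x y, (i <= s.+1)%N -> G i x -> G i y -> G i (x * y).
Hypothesis GV : forall i x, (i <= s.+1)%N -> G i x -> exists2 y, G i y & x * y = 1.
Hypothesis GS : forall i, (i <= s)%N -> G i.+1 `<=` G i.
Hypothesis G_nbhd : forall i, (i <= s.+1)%N -> is_nbhd v [set y | G i (1 + y)].
Hypothesis G_decomposition : forall i x, (i <= s)%N -> G i x ->
  exists b u, [/\ G i b, B i b, G i.+1 u & x = b * u].
Hypothesis G_normal : forall i x y u, (i <= s.+1)%N -> G 0 x -> y * x = 1 ->
  G i u -> G i (y * u * x).
Hypothesis psi_conj : forall i b b' u, (i <= s)%N -> B i b -> b' * b = 1 ->
  psi i (b' * u * b) = psi i u.
Hypothesis theta_smooth : forall i, (i <= s)%N -> smooth_char v (G i) (theta i).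
Hypothesis theta_det : forall i, (i <= s)%N -> factors_through_det (E i) (G i) (theta i).
Hypothesis theta_step : forall i x, (i < s)%N -> G i.+1 x -> theta i x = theta i.+1 x * psi i x.
Hypothesis theta_last : forall x, G s.+1 x -> theta s x = psi s x.

Let A_neq0 : (1 : A) <> 0.
Proof. by have [hs _] := hE (leq0n s); apply: (subfield_neq0 hs). Qed.

Let B_mono i j : (i <= j <= s)%N -> B i `<=` B j.
Proof.
move=> /andP [/subnKC <-]; elim: (j - i)%N => [|n IH] le; first by rewrite addn0.
rewrite addnS in le *; apply: subset_trans (IH (ltnW le)) _ => x Bx a Ea.
by apply: Bx; apply: EE.
Qed.

Let G_mono i j : (i <= j <= s.+1)%N -> G j `<=` G i.
Proof.
move=> /andP [/subnKC <-]; elim: (j - i)%N => [|n IH] le; first by rewrite addn0.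
rewrite addnS in le *; apply: subset_trans (IH (ltnW le)).
exact: GS.
Qed.

Let G_units i x : (i <= s)%N -> G i x -> B i x -> units_of (B i) x.
Proof.
move=> le Gx Bx; have [y _ xy] := GV (leqW le) Gx.
exact: (units_end_overP Bx xy).
Qed.

Let thetaM i x y : (i <= s)%N -> G i x -> G i y -> theta i (x * y) = theta i x * theta i y.
Proof. by move=> /theta_smooth [h _ _]; apply: h. Qed.

Let theta_neq0 i x : (i <= s)%N -> G i x -> theta i x != 0.
Proof. by move=> /theta_smooth [_ h _] Gx; apply/eqP/h. Qed.

Let theta_near1 i : (i <= s)%N ->
  exists2 U, is_nbhd v U & forall y, U y -> G i (1 + y) -> theta i (1 + y) = 1.
Proof.
move=> /theta_smooth [_ _ [L latL hL]]; exists L; first exact: (lattice_nbhd A_neq0).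
by move=> y Ly Gy; apply: hL; rewrite // addrC addKr.
Qed.

(** On G i.+1, psi i is theta s or a quotient of theta i by theta i.+1. *)
Let psiM i x y : (i <= s)%N -> G i.+1 x -> G i.+1 y -> psi i (x * y) = psi i x * psi i y.
Proof.
move=> le Gx Gy; have Gxy := GM (i := i.+1) le Gx Gy.
have [lt|ge] := ltnP i s; last first.
  have ei : i = s by apply/eqP; rewrite eqn_leq le.
  by rewrite ei in Gx Gy Gxy *; rewrite -!theta_last // thetaM //; apply: GS.
apply: (mulfI (theta_neq0 lt Gxy)); rewrite -(theta_step lt Gxy).
rewrite (thetaM le (GS le Gx) (GS le Gy)) (thetaM lt Gx Gy).
by rewrite (theta_step lt Gx) (theta_step lt Gy) mulrACA.
Qed.

Let psi_neq0 i x : (i <= s)%N -> G i.+1 x -> psi i x != 0.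
Proof.
move=> le Gx; have := theta_neq0 le (GS le Gx).
have [lt|ge] := ltnP i s; first by rewrite (theta_step lt Gx) mulf_eq0 negb_or => /andP [].
have ei : i = s by apply/eqP; rewrite eqn_leq le.
by rewrite ei in Gx *; rewrite theta_last.
Qed.

Let psi_near1 i : (i <= s)%N ->
  exists2 U, is_nbhd v U & forall y, U y -> G i.+1 (1 + y) /\ psi i (1 + y) = 1.
Proof.
move=> le; have [U Unbhd hU] := theta_near1 le.
have [lt|ge] := ltnP i s; last first.
  have ei : i = s by apply/eqP; rewrite eqn_leq le.
  subst i; exists (U `&` [set y | G s.+1 (1 + y)]).
    by apply: nbhdI => //; apply: G_nbhd.
  by move=> y [Uy Gy]; rewrite -theta_last // hU //; apply: GS.
have [U' Unbhd' hU'] := theta_near1 lt.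
exists ((U `&` U') `&` [set y | G i.+1 (1 + y)]).
  by apply: nbhdI; [exact: nbhdI|exact: G_nbhd].
move=> y [[Uy U'y] Gy]; split=> //.
by have := theta_step lt Gy; rewrite hU ?hU' ?mul1r //; apply: GS.
Qed.

(** Descending induction on i: phi i is obtained from the quotient of theta i by
    the contribution of the phi l with l > i, called tail below.  Near 1 this
    quotient is psi i, hence trivial. *)
Lemma phi_exist : exists phi : nat -> A -> C, forall i, (i <= s)%N ->
  smooth_char v (units_of (E i)) (phi i) /\
  forall x, G i x -> B i x -> theta i x = \prod_(i <= l < s.+1) phi l (det_over (E l) x).
Proof.
suff main j : (j <= s.+1)%N -> exists phi : nat -> A -> C, forall i, (s.+1 - j <= i <= s)%N ->
    smooth_char v (units_of (E i)) (phi i) /\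
    forall x, G i x -> B i x -> theta i x = \prod_(i <= l < s.+1) phi l (det_over (E l) x).
  by have [phi h] := main s.+1 (leqnn _); exists phi => i le; apply: h; rewrite subnn.
elim: j => [|j IH] lej.
  by exists (fun _ _ => 1) => i; rewrite subn0 => /andP [lt le]; rewrite ltnNge le in lt.
have [phi hphi] := IH (ltnW lej).
pose i := (s - j)%N; have le : (i <= s)%N by apply: leq_subr.
have hi : (s.+1 - j)%N = i.+1 by rewrite subSn.
have [hEi FEi] := hE le.
pose tail x := \prod_(i.+1 <= l < s.+1) phi l (det_over (E l) x).
have tail_char l : (i < l <= s)%N ->
    (forall x y, units_of (B i) x -> units_of (B i) y ->
       phi l (det_over (E l) (x * y)) = phi l (det_over (E l) x) * phi l (det_over (E l) y)) /\
    (forall x, units_of (B i) x -> phi l (det_over (E l) x) != 0).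
  move=> /andP [il ls]; have [hEl FEl] := hE ls.
  have := hphi l; rewrite hi il ls => /(_ isT) [[phiM phi0 _] _].
  have sub x : units_of (B i) x -> units_of (B l) x.
    have Bil : B i `<=` B l by apply: B_mono; rewrite (ltnW il).
    by move=> [Bx [y By xy]]; split; [exact: Bil|exists y => //; exact: Bil].
  have detU x : units_of (B i) x -> units_of (E l) (det_over (E l) x).
    move=> /sub ux; apply: (subfield_units hEl); last exact: det_over_neq0.
    by apply: det_over_field => //; case: ux.
  split=> [x y ux uy|x ux]; last by apply/eqP/phi0/detU.
  rewrite (det_overM hEl FEl (proj1 (sub _ ux)) (proj1 (sub _ uy))).
  exact: (phiM _ _ (detU _ ux) (detU _ uy)).
have tailM x y : units_of (B i) x -> units_of (B i) y -> tail (x * y) = tail x * tail y.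
  move=> ux uy; rewrite -big_split; apply: eq_big_nat => l.
  by move=> /tail_char [h _]; apply: h.
have tail0 x : units_of (B i) x -> tail x != 0.
  move=> ux; rewrite prodf_seq_neq0; apply/allP => l.
  by rewrite mem_index_iota => /tail_char [_ h]; apply: h.
have tailE x : G i.+1 x -> B i x -> theta i x = tail x * psi i x.
  move=> Gx Bx; have [lt|ge] := ltnP i s.
    rewrite (theta_step lt Gx); congr (_ * _).
    have := hphi i.+1; rewrite hi leqnn lt => /(_ isT) [_ h]; apply: h => //.
    by apply: (@B_mono i) Bx; rewrite leqnSn.
  have ei : i = s by apply/eqP; rewrite eqn_leq le.
  rewrite /tail big_geq ?mul1r; last by rewrite ei.
  by move: Gx; rewrite ei; apply: theta_last.
have [U Unbhd hU] := psi_near1 le; have [U' Unbhd' hU'] := theta_near1 le.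
have [||||||||new new_smooth newE] := @smooth_char_through_det _ v _ R (E i) hEi FEi
    (G i `&` B i) (fun x => theta i x / tail x).
- by move=> x [].
- by split; [apply: G1; apply: leqW|apply: end_over1].
- by move=> x y [Gx Bx] [Gy By]; split; [apply: GM => //; apply: leqW|apply: end_overM].
- move=> x [Gx Bx]; have [y Gy xy] := GV (leqW le) Gx.
  by exists y => //; split=> //; apply: (end_overV Bx xy).
- move=> x y [Gx Bx] [Gy By]; rewrite (thetaM le Gx Gy).
  by rewrite (tailM _ _ (G_units le Gx Bx) (G_units le Gy By)) invfM mulrACA.
- move=> x [Gx Bx]; apply: mulf_neq0; first exact: theta_neq0.
  by rewrite invr_neq0 //; apply: tail0; apply: G_units.
- move=> x y [Gx Bx] [Gy By] dxy.
  have ux := G_units le Gx Bx; have uy := G_units le Gy By.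
  have [chi hchi] := theta_det le; rewrite (hchi x Gx ux) (hchi y Gy uy) dxy; congr (_ / _).
  by apply: (char_factors_det v hEi FEi tailM tail0).
- exists (U `&` U'); first exact: nbhdI.
  move=> y [Uy U'y] By; have [Gy psiy] := hU y Uy.
  have Giy := GS le Gy.
  split=> //; have := tailE _ Gy By; rewrite psiy mulr1 => <-.
  by apply: divff; apply: theta_neq0.
exists (fun l => if l == i then new else phi l) => l; rewrite subSS => /andP [il ls].
have phi_tail k x : (i < k)%N ->
    \prod_(k <= l < s.+1) (if l == i then new else phi l) (det_over (E l) x) =
    \prod_(k <= l < s.+1) phi l (det_over (E l) x).
  move=> ik; apply: eq_big_nat => p /andP [kp _].
  by rewrite gtn_eqF // (leq_trans ik).
have [eli|nli] := eqVneq l i; last first.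
  have il' : (i < l)%N by rewrite ltn_neqAle eq_sym nli.
  have := hphi l; rewrite hi il' ls => /(_ isT) [h1 h2]; split=> // x Gx Bx.
  by rewrite phi_tail //; apply: h2.
subst l; split=> // x Gx Bx.
rewrite big_ltn // eqxx phi_tail // -(newE x (conj Gx Bx)).
by rewrite -[\prod_(_ <= _ < _) _]/(tail x) divfK //; apply: tail0; apply: G_units.
Qed.

(** As B grows with i, the successive factors b can be collected. *)
Lemma G0_decomposition i x : (i <= s)%N -> G 0 x ->
  exists b u, [/\ G 0 b, B i b, G i.+1 u & x = b * u].
Proof.
move=> + Gx; elim: i => [|i IH] le; first exact: G_decomposition.
have [b [u [Gb Bb Gu ->]]] := IH (ltnW le).
have [b' [u' [Gb' Bb' Gu' ->]]] := G_decomposition le Gu.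
exists (b * b'), u'; split; rewrite ?mulrA //.
  apply: GM => //; apply: (@G_mono 0 i.+1) Gb'; exact: leqW.
by apply: end_overM => //; apply: (@B_mono i) Bb; rewrite leqnSn.
Qed.

(** The i-th factor sends b * u, with b in B i and u in G i.+1, to
    phi i (det b) * psi i u.  This is well defined because both prescriptions
    agree on the intersection of B i and G i.+1, and multiplicative because
    psi i is invariant under conjugation by b. *)
Theorem factorisation : exists phi : nat -> A -> C,
  (forall i, (i <= s)%N -> smooth_char v (units_of (E i)) (phi i)) /\
  exists theta_ : nat -> A -> C,
    [/\ forall i, (i <= s)%N ->
         [/\ smooth_char v (G 0) (theta_ i),
             forall x, G 0 x -> B i x -> theta_ i x = phi i (det_over (E i) x)
           & forall x, G i.+1 x -> theta_ i x = psi i x],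
        forall i chi, (i <= s)%N ->
          (forall x y, G 0 x -> G 0 y -> chi (x * y) = chi x * chi y) ->
          (forall x, G 0 x -> B i x -> chi x = phi i (det_over (E i) x)) ->
          (forall x, G i.+1 x -> chi x = psi i x) ->
          forall x, G 0 x -> chi x = theta_ i x
      & forall x, G 0 x -> theta 0%N x = \prod_(i < s.+1) theta_ i x].
Proof.
have [phi hphi] := phi_exist; exists phi; split; first by move=> i /hphi [].
pose delta i x := phi i (det_over (E i) x).
have G0S i x : (i <= s)%N -> G i.+1 x -> G 0 x.
  by move=> le; apply: (@G_mono 0 i.+1).
have units0 i x : (i <= s)%N -> G 0 x -> B i x -> units_of (B i) x.
  by move=> le Gx Bx; have [y _ xy] := GV (leq0n _) Gx; apply: (units_end_overP Bx xy).
have detU i x : (i <= s)%N -> units_of (B i) x -> units_of (E i) (det_over (E i) x).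
  move=> le ux; have [hEi FEi] := hE le.
  apply: (subfield_units hEi); last exact: (det_over_neq0 hEi FEi).
  by apply: (det_over_field hEi FEi); case: ux.
have deltaM i x y : (i <= s)%N -> G 0 x -> B i x -> G 0 y -> B i y ->
    delta i (x * y) = delta i x * delta i y.
  move=> le Gx Bx Gy By; have [hEi FEi] := hE le; have [[phiM _ _] _] := hphi i le.
  rewrite /delta (det_overM hEi FEi Bx By).
  by apply: phiM; apply: detU => //; apply: units0.
have delta0 i x : (i <= s)%N -> G 0 x -> B i x -> delta i x != 0.
  move=> le Gx Bx; have [[_ h _] _] := hphi i le; apply/eqP; apply: h.
  by apply: detU => //; apply: units0.
have prodE i x : (i <= s)%N -> G i x -> B i x -> theta i x = \prod_(i <= l < s.+1) delta l x.
  by move=> le; have [_ h] := hphi i le; apply: h.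
(* the formulas for theta i and theta i.+1 differ by delta i, the values by psi i *)
have compat i x : (i <= s)%N -> G i.+1 x -> B i x -> delta i x = psi i x.
  move=> le Gx Bx; have := prodE i x le (GS le Gx) Bx; rewrite big_ltn //.
  have [lt|ge] := ltnP i s.
    have Bx' : B i.+1 x by apply: (@B_mono i) Bx; rewrite leqnSn.
    rewrite (theta_step lt Gx) -(prodE _ _ lt Gx Bx') mulrC => /esym.
    by apply: mulIf; apply: theta_neq0.
  have ei : i = s by apply/eqP; rewrite eqn_leq le.
  rewrite [X in _ * X]big_geq ?mulr1; last by rewrite ei.
  by move=> <-; move: Gx; rewrite ei; apply: theta_last.
have welldef i b u b' u' : (i <= s)%N -> G 0 b -> B i b -> G i.+1 u ->
    G 0 b' -> B i b' -> G i.+1 u' -> b * u = b' * u' ->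
    delta i b * psi i u = delta i b' * psi i u'.
  move=> le Gb Bb Gu Gb' Bb' Gu' e.
  have [c Gc b'c] := GV (leq0n _) Gb'; have cb' := end_mul1C b'c.
  have [w Gw uw] := GV (i := i.+1) le Gu.
  have ez : c * b = u' * w.
    by rewrite -[c * b]mulr1 -uw mulrA -[c * b * u]mulrA e mulrA cb' mul1r.
  have Gz : G i.+1 (c * b) by rewrite ez; apply: GM.
  have Bz : B i (c * b) by apply: end_overM => //; apply: (end_overV Bb' b'c).
  have eb : b = b' * (c * b) by rewrite mulrA b'c mul1r.
  have eu : u' = c * b * u by rewrite ez -mulrA (end_mul1C uw) mulr1.
  rewrite {1}eb eu (deltaM i _ _ le Gb' Bb' (G0S _ _ le Gz) Bz).
  by rewrite (psiM le Gz Gu) (compat _ _ le Gz Bz) mulrA.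
(* t (i, x) is the value at x of the i-th factor *)
have total (ix : nat * A) : exists c : C, forall b u, (ix.1 <= s)%N ->
    G 0 b -> B ix.1 b -> G ix.1.+1 u -> ix.2 = b * u -> c = delta ix.1 b * psi ix.1 u.
  case: ix => i x /=.
  have [[b [u [le Gb Bb Gu e]]]|n] := pselect (exists b u,
      [/\ (i <= s)%N, G 0 b, B i b, G i.+1 u & x = b * u]).
    exists (delta i b * psi i u) => b' u' _ Gb' Bb' Gu' e'.
    by apply: welldef; rewrite // -e.
  by exists 0 => b u le Gb Bb Gu e; case: n; exists b, u.
have [t ht] := choice total.
have tE i b u : (i <= s)%N -> G 0 b -> B i b -> G i.+1 u ->
    t (i, b * u) = delta i b * psi i u.
  by move=> le Gb Bb Gu; apply: (ht (i, b * u)).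
have delta1 i : (i <= s)%N -> delta i 1 = 1.
  move=> le; have G01 : G 0 1 by apply: G1.
  have B1 : B i 1 by apply: end_over1.
  by apply: (mulfI (delta0 _ _ le G01 B1)); rewrite -(deltaM i) // !mulr1.
have psi1 i : (i <= s)%N -> psi i 1 = 1.
  move=> le; have Gi1 : G i.+1 1 by apply: G1.
  by apply: (mulfI (psi_neq0 le Gi1)); rewrite -(psiM le) // !mulr1.
have tB i x : (i <= s)%N -> G 0 x -> B i x -> t (i, x) = delta i x.
  move=> le Gx Bx; rewrite -[x in LHS]mulr1 (tE _ _ _ le Gx Bx) ?psi1 ?mulr1 //.
  exact: G1.
have tG i x : (i <= s)%N -> G i.+1 x -> t (i, x) = psi i x.
  move=> le Gx; rewrite -[x in LHS]mul1r (tE _ _ _ le _ _ Gx) ?delta1 ?mul1r //.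
    exact: G1.
  exact: end_over1.
have tM i x y : (i <= s)%N -> G 0 x -> G 0 y -> t (i, x * y) = t (i, x) * t (i, y).
  move=> le Gx Gy.
  have [b [u [Gb Bb Gu ->]]] := G0_decomposition le Gx.
  have [b' [u' [Gb' Bb' Gu' ->]]] := G0_decomposition le Gy.
  have [c Gc b'c] := GV (leq0n _) Gb'; have cb' := end_mul1C b'c.
  have Gcu : G i.+1 (c * u * b') by apply: G_normal.
  have -> : b * u * (b' * u') = (b * b') * (c * u * b' * u').
    by rewrite !mulrA -[b * b' * c]mulrA b'c mulr1.
  rewrite (tE _ _ _ le Gb Bb Gu) (tE _ _ _ le Gb' Bb' Gu').
  rewrite (tE i (b * b')) //; [|exact: GM|exact: end_overM|exact: GM].
  rewrite (deltaM i _ _ le Gb Bb Gb' Bb') (psiM le Gcu Gu') (psi_conj u le Bb' cb').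
  by rewrite mulrACA.
exists (fun i x => t (i, x)); split.
- move=> i le; split; [split| |].
  + by move=> x y; apply: tM.
  + move=> x Gx; have [b [u [Gb Bb Gu ->]]] := G0_decomposition le Gx.
    rewrite (tE _ _ _ le Gb Bb Gu); apply/eqP; apply: mulf_neq0; first exact: delta0.
    exact: psi_neq0.
  + have [U Unbhd hU] := psi_near1 le.
    have [L latL LU] := nbhd_lattice A_neq0 Unbhd; exists L => // x _ /LU /hU.
    by rewrite addrC subrK => -[Gx px]; rewrite tG.
  + by move=> x; apply: tB.
  + by move=> x; apply: tG.
- move=> i chi le chiM chiB chiG x Gx.
  have [b [u [Gb Bb Gu ->]]] := G0_decomposition le Gx.
  by rewrite (chiM _ _ Gb (G0S _ _ le Gu)) (chiB _ Gb Bb) (chiG _ Gu) (tE _ _ _ le Gb Bb Gu).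
- move=> x Gx.
  (* on x = b * u the formula comes from that of phi_exist for b and, by
     descending induction on i, from the one for theta i.+1 at u *)
  suff main j i : (i + j = s)%N -> forall x, G i x -> theta i x = \prod_(i <= l < s.+1) t (l, x).
    by rewrite (main s 0%N) // big_mkord.
  elim: j i {x Gx} => [|j IH] i eij x Gx.
    rewrite addn0 in eij; subst i; rewrite big_nat1.
    have [b [u [Gb Bb Gu ->]]] := G_decomposition (leqnn s) Gx.
    rewrite tE //; last by apply: (@G_mono 0 s) Gb; rewrite leqnSn.
    rewrite thetaM //; last exact: GS.
    by rewrite (theta_last Gu) (prodE s b) // big_nat1.
  have lt : (i < s)%N by rewrite -eij addnS ltnS leq_addr.
  have le := ltnW lt.
  have [b [u [Gb Bb Gu ->]]] := G_decomposition le Gx.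
  have Gb0 : G 0 b by apply: (@G_mono 0 i) Gb; apply: leqW.
  have Gu0 := G0S _ _ le Gu.
  rewrite (thetaM le Gb (GS le Gu)) (prodE _ _ le Gb Bb) (theta_step lt Gu).
  rewrite (IH i.+1) ?addSn -?addnS // -(tG _ _ le Gu) [_ * t _]mulrC.
  rewrite -(@big_ltn _ _ _ i s.+1 (fun l => t (l, u))) // -big_split.
  apply: eq_big_nat => l /andP [il ls].
  rewrite tM // (tB l b) //.
  by apply: (@B_mono i) Bb; rewrite il.
Qed.

End Factorisation.

(** * The filtration attached to a defining sequence *)

Section Filtration.
Variables (F : fieldType) (v : local_valuation F) (V : vectType F) (S : set 'End(V)).
Local Notation A := 'End(V).
Hypothesis A_neq0 : (1 : A) <> 0.
Hypothesis hS : hereditary_order v (scalar_field V) S.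
Variables (s : nat) (E : nat -> set A) (k : nat -> nat) (h : nat -> set A).
Local Notation P := (ideal_pow S (jacobson_radical S)).
Local Notation B i := (End_over (E i)).
Hypothesis EE : forall i, (i < s)%N -> E i.+1 `<=` E i.
Hypothesis k_gt0 : forall i, (0 < k i)%N.
Hypothesis k_mono : forall i, (i <= s)%N -> (k i <= k i.+1)%N.
Hypothesis h_last : h s.+1 = S.
Hypothesis h_step : forall i, (i <= s)%N ->
  h i = [set x + y | x in S `&` B i & y in h i.+1 `&` P (k i.+1)].
Implicit Types (x y : A).

(** For the h i attached to a defining sequence this is H^(k i)(beta_i, S), and
    1 + P^(k s.+1) for i = s.+1. *)
Definition filtration_group (i : nat) : set A := [set x | h i x /\ P (k i) (x - 1)].
Local Notation G := filtration_group.

Let ring_S := order_subring A_neq0 hS.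

Let PJ m y : (0 < m)%N -> P m y -> jacobson_radical S y.
Proof. by case: m => // m _; apply: (radical_powSJ A_neq0 hS). Qed.

Let B_order i : is_subring (S `&` B i).
Proof.
split; first by split; [exact: (subring1 ring_S)|exact: end_over1].
move=> x y [Sx Bx] [Sy By]; split; split.
- exact: (subringB ring_S).
- by apply: end_overD => //; apply: end_overN.
- exact: (subringM ring_S).
- exact: end_overM.
Qed.

(** Since the order of B i is contained in that of B i.+1, hence in the ring
    h i.+1, the intersection of h i.+1 with a power of the radical is stable
    under it. *)
Lemma filtration_rings i : (i <= s.+1)%N ->
  [/\ is_subring (h i), h i `<=` S & (i <= s)%N -> S `&` B i `<=` h i /\ h i `<=` h i.+1].
Proof.
suff main j : (j <= s.+1)%N ->
    [/\ is_subring (h (s.+1 - j)), h (s.+1 - j) `<=` S &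
       (s.+1 - j <= s)%N -> S `&` B (s.+1 - j) `<=` h (s.+1 - j) /\ h (s.+1 - j) `<=` h (s.+1 - j).+1].
  by move=> le; have := main (s.+1 - i)%N; rewrite subKn // => /(_ (leq_subr _ _)).
elim: j {i} => [|j IH] lej; first by rewrite subn0 h_last; split=> //; rewrite ltnn.
have [] := IH (ltnW lej); rewrite subSS subSn //.
set i := (s - j)%N => ring_h hS' hB.
have le : (i <= s)%N by apply: leq_subr.
have hi := h_step le.
have BB : S `&` B i `<=` h i.+1.
  move=> x [Sx Bx]; have [lt|ge] := ltnP i s; last first.
    have ei : i = s by apply/eqP; rewrite eqn_leq le.
    by rewrite ei h_last.
  have [sub _] := hB lt; apply: sub; split=> // a Ea.
  by apply: Bx; apply: EE.
have P0 m := radical_pow0 A_neq0 hS m.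
have sub : h i `<=` h i.+1.
  by rewrite hi => _ [b Bb [y [hy _] <-]]; apply: (subringD ring_h) => //; apply: BB.
have subB : S `&` B i `<=` h i.
  rewrite hi => x Bx; exists x => //; exists 0; rewrite ?addr0 //.
  by split; [exact: (subring0 ring_h)|exact: P0].
split=> //; last by move=> x /sub; apply: hS'.
split; first by apply: subB; exact: (subring1 (B_order i)).
have PD m := @radical_powD _ _ _ _ A_neq0 hS m.
have PN m := @radical_powN _ _ _ _ A_neq0 hS m.
rewrite hi => _ _ [b Bb [y [hy Py] <-]] [b' Bb' [y' [hy' Py'] <-]]; split.
  exists (b - b'); first exact: (subringB (B_order i)).
  exists (y - y'); last by rewrite opprD addrACA.
  by split; [exact: (subringB ring_h)|apply: PD => //; exact: PN].
exists (b * b'); first exact: (subringM (B_order i)).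
exists (b * y' + y * (b' + y')); last by rewrite [RHS]mulrDl [b * (_ + _)]mulrDr addrA.
have hb := BB _ Bb; have hb' := BB _ Bb'.
split.
  apply: (subringD ring_h); first exact: (subringM ring_h).
  by apply: (subringM ring_h) => //; apply: (subringD ring_h).
apply: PD; first by apply: (radical_powMl A_neq0 hS) => //; case: Bb.
apply: (radical_powMr A_neq0 hS) => //; apply: (subringD ring_S); first by case: Bb'.
exact: hS'.
Qed.

Let ring_h i : (i <= s.+1)%N -> is_subring (h i).
Proof. by move=> /filtration_rings []. Qed.

Let hsubS i : (i <= s.+1)%N -> h i `<=` S.
Proof. by move=> /filtration_rings []. Qed.

Let hB i : (i <= s)%N -> S `&` B i `<=` h i.
Proof. by move=> le; have [_ _ /(_ le) []] := filtration_rings (leqW le). Qed.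

Let hS1 i : (i <= s)%N -> h i `<=` h i.+1.
Proof. by move=> le; have [_ _ /(_ le) []] := filtration_rings (leqW le). Qed.

Lemma filtration_ring_mono i j : (i <= j <= s.+1)%N -> h i `<=` h j.
Proof.
move=> /andP [/subnKC <-]; elim: (j - i)%N => [|n IH] le; first by rewrite addn0.
rewrite addnS in le *; apply: subset_trans (IH (ltnW le)) _.
exact: hS1.
Qed.

Let P_le m l : (m <= l)%N -> P l `<=` P m.
Proof. exact: (radical_pow_le A_neq0 hS). Qed.

Lemma filtration_group1 i : (i <= s.+1)%N -> G i 1.
Proof.
move=> le; split; first exact: (subring1 (ring_h le)).
by rewrite subrr; apply: (radical_pow0 A_neq0 hS).
Qed.

Lemma filtration_groupM i x y : (i <= s.+1)%N -> G i x -> G i y -> G i (x * y).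
Proof.
move=> le [hx Px] [hy Py]; split; first exact: (subringM (ring_h le)).
rewrite (_ : x * y - 1 = (x - 1) * y + (y - 1)); last by rewrite mulrBl mul1r addrA subrK.
apply: (radical_powD A_neq0 hS) => //.
by apply: (radical_powMr A_neq0 hS) => //; apply: (hsubS le).
Qed.

Lemma filtration_groupS i : (i <= s)%N -> G i.+1 `<=` G i.
Proof.
move=> le x [hx Px]; split; last exact: (P_le (k_mono le)).
rewrite h_step //; exists 1.
  by split; [exact: (subring1 ring_S)|exact: end_over1].
exists (x - 1); last by rewrite addrC subrK.
split=> //; apply: (subringB (ring_h (i := i.+1) _)) => //.
exact: (subring1 (ring_h _)).
Qed.

Lemma filtration_group_sub i j : (i <= j <= s.+1)%N -> G j `<=` G i.
Proof.
move=> /andP [/subnKC <-]; elim: (j - i)%N => [|n IH] le; first by rewrite addn0.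
rewrite addnS in le *; apply: subset_trans (IH (ltnW le)).
exact: filtration_groupS.
Qed.

(** If x = b + w, then b is in 1 + P, so it has an inverse c in the order of B i and
    x = b * (1 + c * w). *)
Lemma filtration_group_decomposition i x : (i <= s)%N -> G i x ->
  exists b u, [/\ G i b, B i b, G i.+1 u & x = b * u].
Proof.
move=> le [+ Px]; rewrite {1}h_step // => -[b [Sb Bb] [w [hw Pw] eb]].
have Pb : P (k i) (b - 1).
  rewrite (_ : b - 1 = (x - 1) - w); last by rewrite -eb addrAC addrK.
  apply: (radical_powD A_neq0 hS) => //; apply: (radical_powN A_neq0 hS).
  exact: (P_le (k_mono le)).
have [c [Sc bc cb]] := one_plus_radical_unit A_neq0 hS (PJ (k_gt0 i) Pb).
rewrite addrC subrK in bc cb.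
have Bc : B i c by apply: (end_overV Bb bc).
have hc : h i.+1 c by apply: hS1 => //; apply: hB.
exists b, (1 + c * w); split=> //.
- by split=> //; apply: hB.
- split.
    apply: (subringD (ring_h (i := i.+1) _)) => //; first exact: (subring1 (ring_h _)).
    exact: (subringM (ring_h (i := i.+1) _)).
  by rewrite addrC addKr; apply: (radical_powMl A_neq0 hS).
- by rewrite mulrDr mulr1 mulrA bc mul1r.
Qed.

(** The decomposition reduces the inverse to the one in G i.+1. *)
Lemma filtration_groupV i x : (i <= s.+1)%N -> G i x -> exists2 y, G i y & x * y = 1.
Proof.
suff main j : (j <= s.+1)%N -> forall x, G (s.+1 - j)%N x -> exists2 y, G (s.+1 - j)%N y & x * y = 1.
  by move=> le; have := main (s.+1 - i)%N; rewrite subKn // => /(_ (leq_subr _ _)); apply.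
have inv1 l y z : (l <= s.+1)%N -> S z -> P (k l) (y - 1) -> z * y = 1 -> P (k l) (z - 1).
  move=> le Sz Py zy; rewrite (_ : z - 1 = - (z * (y - 1))); last by rewrite mulrBr zy mulr1 opprB.
  by apply: (radical_powN A_neq0 hS); apply: (radical_powMl A_neq0 hS).
elim: j {i x} => [|j IH] lej x.
  rewrite subn0 => -[hx Px].
  have [z [Sz xz zx]] := one_plus_radical_unit A_neq0 hS (PJ (k_gt0 _) Px).
  rewrite addrC subrK in xz zx.
  by exists z => //; split; [rewrite h_last|apply: (inv1 s.+1 x)].
move: (IH (ltnW lej)); rewrite subSS subSn //.
set i := (s - j)%N => {}IH Gx.
have le : (i <= s)%N by apply: leq_subr.
have [b [u [[hb Pb] Bb Gu ->]]] := filtration_group_decomposition le Gx.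
have [u' Gu' uu'] := IH _ Gu.
have [c [Sc bc cb]] := one_plus_radical_unit A_neq0 hS (PJ (k_gt0 i) Pb).
rewrite addrC subrK in bc cb.
exists (u' * c); last by rewrite mulrA -[b * u * u']mulrA uu' mulr1.
apply: filtration_groupM; [exact: leqW|exact: filtration_groupS|].
split; first by apply: hB => //; split=> //; apply: (end_overV Bb bc).
by apply: (inv1 i b) => //; apply: leqW.
Qed.

Lemma filtration_group_nbhd i : (i <= s.+1)%N -> is_nbhd v [set y | G i (1 + y)].
Proof.
move=> le; apply: nbhdW (radical_pow_nbhd A_neq0 hS (k s.+1)) => y Py.
apply: (@filtration_group_sub i s.+1); first by rewrite le leqnn.
split; last by rewrite addrC addKr.
rewrite h_last; apply: (subringD ring_S); first exact: (subring1 ring_S).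
exact: (P_le (leq0n _) Py).
Qed.

Lemma filtration_group_normal i x y u : (i <= s.+1)%N -> G 0 x -> y * x = 1 ->
  G i u -> G i (y * u * x).
Proof.
move=> le Gx yx [hu Pu].
have [y' Gy' xy'] := filtration_groupV (leq0n _) Gx.
have ey : y = y' by rewrite -[y]mulr1 -xy' mulrA yx mul1r.
have [hy _] : G 0 y by rewrite ey.
have [hx _] := Gx.
have sub := filtration_ring_mono (i := 0) (j := i) le.
split; first by apply: (subringM (ring_h le)); [apply: (subringM (ring_h le))|] => //; apply: sub.
rewrite (_ : _ - 1 = y * (u - 1) * x); last by rewrite mulrBr mulr1 mulrBl yx.
apply: (radical_powMr A_neq0 hS); first by apply: (hsubS (leq0n _)).
by apply: (radical_powMl A_neq0 hS) => //; apply: (hsubS (leq0n _)).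
Qed.

Lemma filtration_group_cut i j x : (i <= j <= s.+1)%N ->
  G j x <-> h i x /\ P (k j) (x - 1).
Proof.
move=> le; split; last by move=> [hx Px]; split=> //; apply: (filtration_ring_mono le).
move=> Gx; have [_ Px] := Gx; split=> //.
by have [] := filtration_group_sub le Gx.
Qed.

End Filtration.

(** * Factorisation of simple characters *)

Section TraceAndAdjunction.
Variables (F : fieldType) (V : vectType F).
Local Notation A := 'End(V).

Lemma trace_mulC (x y : A) : trace (x * y) = trace (y * x).
Proof.
have b := vbasisP {:V}.
by rewrite /trace !(passmx.mxof_comp _ _ b) mxtrace_mulC.
Qed.

Lemma adjoin_scalar (b : A) : scalar_field V `<=` F[b].
Proof.
move=> a Fa; exists [:: a]; first by move=> a'; rewrite inE => /eqP ->.
by rewrite big_ord_recl big_ord0 addr0 expr0 mulr1.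
Qed.

Lemma adjoin_gen (b : A) : F[b] b.
Proof.
exists [:: 0; 1].
  move=> a; rewrite !inE => /orP [] /eqP ->; first by exists 0; rewrite ?scale0r.
  by exists 1; rewrite ?scale1r.
by rewrite !big_ord_recl big_ord0 /= mul0r add0r expr1 mul1r addr0.
Qed.

(** The trace is invariant under conjugation, and c commutes with b. *)
Lemma psi_at_conj (R : realType) (psi : F -> R[i]) (E : set A) (c b b' u : A) :
  E c -> End_over E b -> b' * b = 1 -> psi_at psi c (b' * u * b) = psi_at psi c u.
Proof.
move=> Ec Bb b'b; have bb' := end_mul1C b'b.
have Bb' : End_over E b' by apply: (end_overV Bb).
rewrite /psi_at (_ : b' * u * b - 1 = b' * ((u - 1) * b)); last first.
  by rewrite mulrBl mul1r mulrBr mulrA b'b.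
by rewrite mulrA -Bb' // -mulrA trace_mulC -!mulrA bb' mulr1.
Qed.

Lemma unit_groupE (S : set A) (m : nat) x : (0 < m)%N ->
  unit_group (scalar_field V) S m%:Z x <-> ideal_pow S (jacobson_radical S) m (x - 1).
Proof.
case: m => // m _; split; first by move=> [y Py <-]; rewrite addrC addKr.
by move=> Px; exists (x - 1); rewrite // addrC subrK.
Qed.

Lemma radical_pow_opp (S : set A) (r : int) x : is_subring S ->
  radical_pow (scalar_field V) S (- r) x -> 0 < r ->
  radical_pow (scalar_field V) S (- r) (- x).
Proof.
move=> ring_S; case: r => [[|m]|m] //= [Bx hx] _; split; first exact: end_overN.
by move=> y /hx; rewrite mulNr; apply: (subringN ring_S).
Qed.

End TraceAndAdjunction.

Theorem theorem0p4 (R : realType) (F : fieldType) (v : local_valuation F)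
    (psi : F -> R[i]) (hpsi : additive_char_conductor_p v psi)
    (V : vectType F) (S : set 'End(V)) (n : int) (beta : 'End(V))
    (hmax : maximal_simple_stratum v (scalar_field V) S n 0 beta)
    (htame : tamely_ramified v F[beta])
    (s : nat) (r_ : nat -> int) (beta_ : nat -> 'End(V))
    (hseq : defining_sequence v S n 0 beta s r_ beta_)
    (hbeta0 : beta_ 0%N = beta)
    (hfields : forall i : nat, (i < s)%N -> F[beta_ i.+1] `<` F[beta_ i])
    (hsimple : forall i : nat, (i < s)%N ->
       simple_stratum v F[beta_ i.+1]
         (centraliser_order (scalar_field V) S (beta_ i.+1))
         (r_ i.+1) (r_ i.+1 - 1) (beta_ i - beta_ i.+1))
    (hbetas : ~ scalar_field V (beta_ s))
    (theta : 'End(V) -> R[i])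
    (htheta : simple_char v psi S n s r_ beta_ 0 0 theta) :
  let E_ i := F[beta_ i] in
  let B_ i := End_over (E_ i) in
  let c_ i := if (i < s)%N then beta_ i - beta_ i.+1 else beta_ i in
  let H1 := Hgroup S n s r_ beta_ 0 1 in
  exists phi_ : nat -> 'End(V) -> R[i],
    (forall i : nat, (i <= s)%N -> smooth_char v (units_of (E_ i)) (phi_ i)) /\
    let is_theta i (chi : 'End(V) -> R[i]) :=
      [/\ smooth_char v H1 chi,
          forall x, H1 x -> B_ i x -> chi x = phi_ i (det_over (E_ i) x)
        & forall x, H1 x ->
            unit_group (scalar_field V) S
              (((- fine (nu (scalar_field V) S (c_ i))) %/ 2)%Z + 1) x ->
            chi x = psi_at psi (c_ i) x] in
    exists theta_ : nat -> 'End(V) -> R[i],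
      [/\ forall i : nat, (i <= s)%N -> is_theta i (theta_ i),
          forall (i : nat) (chi : 'End(V) -> R[i]), (i <= s)%N -> is_theta i chi ->
            forall x, H1 x -> chi x = theta_ i x
        & forall x, H1 x -> theta x = \prod_(i < s.+1) theta_ i x].
Proof.
move=> E_ B_ c_ H1.
have pure i : (i <= s)%N -> pure_stratum v (scalar_field V) S n (r_ i) (beta_ i).
  by move=> /(ds_simple hseq) [].
have [[hS _ _ _] hE0 _ _] := pure 0%N (leq0n _).
have A_neq0 := subfield_neq0 hE0.
have ring_S := order_subring A_neq0 hS.
have hE i : (i <= s)%N -> is_subfield (E_ i) /\ scalar_field V `<=` E_ i.
  by move=> /pure [_ h _ _]; split=> //; apply: adjoin_scalar.
have EE i : (i < s)%N -> E_ i.+1 `<=` E_ i by move=> /hfields [].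
(* setting r s.+1 = n, the valuation of c_ i is - r i.+1 for i = s as well *)
pose r i := if (i <= s)%N then r_ i else n.
have [rS rn] := ds_incr hseq; have [r00 _] := ds_start hseq.
have r0 : r 0%N = 0 by rewrite /r leq0n.
have r_lt i : (i <= s)%N -> r i < r i.+1.
  move=> le; rewrite /r le; case: ltnP => [|ge]; first exact: rS.
  by have -> : i = s by apply/eqP; rewrite eqn_leq le.
have r_ge0 i : (i <= s.+1)%N -> 0 <= r i.
  elim: i => [|i IH] le; first by rewrite r0.
  by apply: le_trans (IH (ltnW le)) (ltW (r_lt _ _)).
pose k i := `|(r i %/ 2)%Z|%N.+1.
have kE i : (i <= s.+1)%N -> (r i %/ 2)%Z + 1 = (k i)%:Z.
  by move=> /r_ge0 ri; rewrite /k; lia.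
have k_mono i : (i <= s)%N -> (k i <= k i.+1)%N.
  move=> le; rewrite /k ltnS; have := r_lt i le; have := r_ge0 i (leqW le); lia.
pose h i := if (i <= s)%N then frakH_rec S n r_ beta_ (s - i) i else S.
have h_last : h s.+1 = S by rewrite /h ltnn.
have h_step i : (i <= s)%N -> h i = [set x + y | x in S `&` B_ i
    & y in h i.+1 `&` ideal_pow S (jacobson_radical S) (k i.+1)].
  move=> le; have := kE i.+1 le; rewrite /h le /r; case: ltnP => [lt ek|ge ek].
    by rewrite -[(s - i)%N](@prednK) ?subn_gt0 // -subnS /= ek.
  have ei : i = s by apply/eqP; rewrite eqn_leq le.
  subst i; rewrite subnn /frakH_rec ek; apply/seteqP; split=> _ [x Bx [y Py <-]].
    exists x => //; exists y => //; split; last exact: Py.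
    exact: (radical_pow_le A_neq0 hS (leq0n _) Py).
  by exists x => //; exists y => //; case: Py.
pose G := filtration_group S k h.
have cut i j x : (i <= j <= s.+1)%N -> G j x <-> h i x /\
    ideal_pow S (jacobson_radical S) (k j) (x - 1).
  exact: (filtration_group_cut A_neq0 hS EE k_mono h_last h_step).
have HE i j : (i <= j <= s.+1)%N -> (i <= s)%N ->
    Hgroup_rec S n r_ beta_ (s - i) i (k j)%:Z = G j.
  move=> le les; apply/seteqP; split=> x.
    by move=> [hx /unit_groupE Px]; apply/(cut i) => //; split; [rewrite /h les|exact: Px].
  move/(cut i _ _ le) => [hx Px]; split; first by rewrite /h les in hx.
  exact/unit_groupE.
have H1E : H1 = G 0%N.
  rewrite -(HE 0%N 0%N) //; congr (Hgroup_rec _ _ _ _ _ _ _).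
  by rewrite /k r0.
have Ec i : (i <= s)%N -> E_ i (c_ i).
  move=> le; rewrite /c_; case: ltnP => [lt|_]; last exact: adjoin_gen.
  apply: (subfieldB (proj1 (hE i le))); first exact: adjoin_gen.
  by apply: EE => //; apply: adjoin_gen.
have nuc i : (i <= s)%N -> nu (scalar_field V) S (c_ i) = (- r i.+1)%:E.
  move=> le; rewrite /c_ /r; case: ltnP => [lt|ge]; last first.
    by have [_ _ _] := pure i le.
  have [[[_ _ Bc _] _ _ nuB] _] := hsimple i lt.
  have [_ _ normE _] := pure i.+1 lt.
  have [hEi FEi] := hE i.+1 lt.
  have rpos : 0 < r_ i.+1.
    by have := r_lt i le; have := r_ge0 i (leqW le); rewrite /r le lt; lia.
  apply: (nu_centraliser A_neq0 hS hEi FEi normE rpos Bc _ nuB).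
  rewrite -opprB; apply: (radical_pow_opp ring_S) => //.
  by have [_] := ds_jump hseq lt.
(* t l is the character theta_l of the group G l *)
have chain j i th : (i + j = s)%N ->
    simple_char_rec v psi S n r_ beta_ j i (r i %/ 2)%Z th ->
    exists t : nat -> 'End(V) -> R[i], t i = th /\ forall l, (i <= l <= s)%N ->
      [/\ smooth_char v (G l) (t l), factors_through_det (E_ l) (G l) (t l),
          (l < s)%N -> forall x, G l.+1 x -> t l x = t l.+1 x * psi_at psi (c_ l) x
        & l = s -> forall x, G l.+1 x -> t l x = psi_at psi (c_ l) x].
  elim: j i th => [|j IH] i th eij.
    rewrite addn0 in eij; subst i => /= -[smooth psiE detE].
    have HsE := HE s s; rewrite subnn !leqnn leqnSn -kE // in HsE.
    rewrite HsE // in smooth psiE detE.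
    exists (fun _ => th); split=> // l /andP [sl ls].
    have -> : l = s by apply/eqP; rewrite eqn_leq sl ls.
    split=> //; first by rewrite ltnn.
    move=> _ x Gx; rewrite /c_ ltnn; apply: psiE.
      exact: (filtration_groupS A_neq0 hS EE k_mono h_last h_step (leqnn s)).
    have /(_ (leqnn _)) := kE s.+1; rewrite {1}/r ltnn => ->.
    apply/unit_groupE => //; by case: Gx.
  have lt : (i < s)%N by rewrite -eij addnS ltnS leq_addr.
  have le := ltnW lt.
  have rE : r_ i.+1 = r i.+1 by rewrite /r lt.
  (* H^(m+1)(beta_i) for m = [r i / 2] is G i, and max (m, [r i.+1 / 2]) gives G i.+1 *)
  have maxE : Order.max (r i %/ 2)%Z (r_ i.+1 %/ 2)%Z = (r i.+1 %/ 2)%Z.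
    by rewrite rE; apply/max_idPr; have := r_lt i le; lia.
  have sij : j.+1 = (s - i)%N by rewrite -eij addKn.
  rewrite -[simple_char_rec _ _ _ _ _ _ _ _ _ _]/(let m' := Order.max (r i %/ 2)%Z (r_ i.+1 %/ 2)%Z in
    [/\ smooth_char v (Hgroup_rec S n r_ beta_ j.+1 i ((r i %/ 2)%Z + 1)) th,
       factors_through_det F[beta_ i] (Hgroup_rec S n r_ beta_ j.+1 i ((r i %/ 2)%Z + 1)) th,
       normalised_by (order_normaliser F[beta_ i] (centraliser_order (scalar_field V) S (beta_ i)))
          (Hgroup_rec S n r_ beta_ j.+1 i ((r i %/ 2)%Z + 1)) th
      & exists2 theta0, simple_char_rec v psi S n r_ beta_ j i.+1 m' theta0
          & forall x, Hgroup_rec S n r_ beta_ j.+1 i (m' + 1) x ->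
              th x = theta0 x * psi_at psi (beta_ i - beta_ i.+1) x]).
  rewrite /= maxE sij !kE // ?(leqW le) //.
  rewrite !HE ?leqnn ?leqnSn ?(leqW le) //.
  move=> [smooth detE _ [theta0 h0 thE]].
  have [|t [t0 ht]] := IH i.+1 theta0 _ h0; first by rewrite addSn -addnS.
  exists (fun l => if l == i then th else t l); rewrite eqxx; split=> // l /andP [il ls].
  have [eli|nli] := eqVneq l i.
    subst l; split=> //; last by move=> e; rewrite e ltnn in lt.
    move=> _ x Gx; rewrite gtn_eqF // t0 /c_ lt; exact: thE.
  have il' : (i < l)%N by rewrite ltn_neqAle eq_sym nli.
  have [|h1 h2 h3 h4] := ht l; first by rewrite il' ls.
  by split=> // lts x Gx; rewrite gtn_eqF ?(ltn_trans il') //; apply: h3.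
have [|t [t0 ht]] := chain s 0%N theta (add0n s).
  by rewrite r0; move: htheta; rewrite /simple_char subn0.
have htl l : (l <= s)%N -> _ := fun le => ht l (introT andP (conj (leq0n l) le)).
have [||||||||||||phi [phi_smooth [theta_ [th_spec th_uniq th_prod]]]] :=
  @factorisation F v V R s E_ G t (fun i => psi_at psi (c_ i)) hE EE.
- by move=> i; apply: (filtration_group1 A_neq0 hS EE h_last h_step).
- by move=> i x y; apply: (filtration_groupM A_neq0 hS EE h_last h_step).
- by move=> i x; apply: (filtration_groupV A_neq0 hS EE _ k_mono h_last h_step).
- by move=> i; apply: (filtration_groupS A_neq0 hS EE k_mono h_last h_step).
- by move=> i; apply: (filtration_group_nbhd A_neq0 hS EE k_mono h_last h_step).
- by move=> i x; apply: (filtration_group_decomposition A_neq0 hS EE _ k_mono h_last h_step).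
- by move=> i x y u; apply: (filtration_group_normal A_neq0 hS EE _ k_mono h_last h_step).
- by move=> i b b' u le; apply: psi_at_conj; apply: Ec.
- by move=> i /htl [].
- by move=> i /htl [].
- by move=> i x lt; have [_ _ h3 _] := htl i (ltnW lt); apply: h3.
- by move=> x; have [_ _ _ h4] := htl s (leqnn s); apply: h4.
have groupE i x : (i <= s)%N -> G 0%N x ->
    unit_group (scalar_field V) S (((- fine (nu (scalar_field V) S (c_ i))) %/ 2)%Z + 1) x <-> G i.+1 x.
  move=> le Gx; rewrite nuc //= opprK kE //.
  have [h0 _] := Gx.
  split; first by move=> /unit_groupE Px; apply/(cut 0%N) => //; split=> //; apply: Px.
  by move=> [_ Px]; apply/unit_groupE.
exists phi; split=> //; exists theta_; rewrite H1E; split=> //.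
- move=> i le; have [h1 h2 h3] := th_spec i le; split=> // x Gx /(groupE i x le Gx).
  exact: h3.
- move=> i chi le [[chiM _ _] chiB chiG]; apply: (th_uniq i) => // x Gx.
  have G0x : G 0%N x by apply: (filtration_group_sub A_neq0 hS EE k_mono h_last h_step (j := i.+1)) Gx.
  by apply: chiG => //; apply/groupE.
- by move=> x Gx; rewrite -t0; apply: th_prod.
Qed.
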